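(* For every non-empty reduced tree $T$, $$\mu_\tau(T)=\frac{(-1)^{n(T)}\cdot\tau}{(\tau-1)^{\ell(T)}}\cdot\prod_x[\tau]_{v(x)}$$ in $\mathbf{Z}[\tau,(\tau-1)^{-1}]$, where the product is over the nodes $x$ of $T$.
   Context: **Trees.** A tree is a finite connected simple graph without cycles; vertices of valence one are leaves (the vertex of the one-point tree counts as a leaf), others nodes; a tree is reduced if it has no nodes of valence two. $\ell(T)$ is the number of leaves, $n(T)$ the number of nodes, and $v(x)$ the valence of a node $x$. The leaf set $L(T)$ carries the quaternary relation: $R(x_1,x_2;y_1,y_2)$ iff the four leaves are distinct and the shortest path joining $x_1,x_2$ has a common edge with the shortest path joining $y_1,y_2$. A tree structure is a finite set with a quaternary relation isomorphic to some $L(T)$ (the empty structure is allowed); tree structures are identified with reduced trees, and $\mathfrak{T}$ is the class of tree structures. **Measures.** An embedding is an injection that is an isomorphism onto its image with the induced relation. For embeddings $X\to Y_\alpha$ in $\mathfrak{T}$, an amalgamation of $Y_1,Y_2$ over $X$ is $Z\in\mathfrak{T}$ with jointly surjective embeddings $Y_\alpha\to Z$ agreeing on $X$, up to isomorphism. A measure for $\mathfrak{T}$ valued in a commutative ring $R$ assigns $\mu(i)\in R$ to each embedding $i$ such that $\mu(i)=1$ for isomorphisms, $\mu(j\circ i)=\mu(j)\mu(i)$, and, for embeddings $i\colon X\to Y$, $X\to X'$ with amalgamations $i'_\alpha\colon X'\to Y'_\alpha$, $\mu(i)=\sum_\alpha\mu(i'_\alpha)$. Write $\mu(T)$ for $\mu(\emptyset\to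 T)$, and $\mu(T,a)$ for $\mu(T\setminus a\to T)$ when $a$ is a leaf of $T$. **The measure $\mu_\tau$.** Let $R=\mathbf{Z}[\tau,(\tau-1)^{-1}]$. $\mu_\tau$ is the unique $R$-valued measure for $\mathfrak{T}$ with $\mu_\tau(X_1)=\frac{\tau}{\tau-1}$, $\mu_\tau(X_2)=\frac1{\tau-1}$, $\mu_\tau(X_m)=\frac{\tau+1-m}{\tau-1}$ for $m\ge4$, and $\mu_\tau(X_3)=\mu_\tau(Y)=\mu_\tau(Z)=-\frac{\tau-2}{\tau-1}$, where these denote values on the following marked trees $(T,a)$: $X_1,X_2$ are the marked trees with 1 and 2 leaves; $X_m$ ($m\ge3$) has one node with $m$ leaves attached, one marked; $Y$ has two adjacent nodes each with two leaves attached, one leaf marked; $Z$ has three nodes in a path, end nodes with two leaves each, and the middle node with one leaf, which is marked. (Equivalently, $\mu_\tau$ corresponds to the homomorphism $\Theta(\mathfrak{T})\cong\mathbf{Z}[u,v]/(uv)\to R$ with $u\mapsto-\frac{\tau-2}{\tau-1}$, $v\mapsto0$, where $\Theta(\mathfrak{T})$ is the target ring of the universal measure and under the isomorphism $Y\mapsto u$, $Z\mapsto u-v$.) **Notation.** For an integer $n\ge3$, $[\tau]_n=(\tau-n+1)\cdots(\tau-2)$ (the product of $\tau-j$ for $2\le j\le n-1$). *)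

(* Defs.v *)
From HB Require Import structures.
From mathcomp Require Import all_boot all_order all_algebra.
From mathcomp Require Import boolp.

Set Implicit Arguments.
Unset Strict Implicit.
Unset Printing Implicit Defensive.

Import GRing.Theory.
Local Open Scope ring_scope.

(** * Trees *)

(* A cycle of length 2 in the sense of [ucycle] is just an edge traversed back
   and forth, hence the bound in [tree_acyclic]. *)
Record tree := Tree {
  vertex :> finType;
  adj : rel vertex;
  adj_sym : symmetric adj;
  adj_irr : irreflexive adj;
  tree_nonempty : (0 < #|vertex|)%N;
  tree_connected : forall x y, connect adj x y;
  tree_acyclic : forall c : seq vertex, ucycle adj c -> (size c <= 2)%N
}.

Section TreeInvariants.
Variable T : tree.

Definition valence (x : T) : nat := #|[set y | adj x y]|.

Definition is_leaf (x : T) : bool := (valence x == 1%N) || (#|T| == 1%N).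

Definition is_node (x : T) : bool := ~~ is_leaf x.

Definition reduced : Prop := forall x : T, is_node x -> valence x <> 2%N.

Definition nleaves : nat := #|[set x : T | is_leaf x]|.

Definition nnodes : nat := #|[set x : T | is_node x]|.

Definition leaves_at (x : T) : nat := #|[set y | adj x y & is_leaf y]|.

(* Paths follow the convention of [path]: the path with vertex sequence
   [x :: p] is given by [x] and [p]. *)
Definition shortest_path (x y : T) (p : seq T) : Prop :=
  [/\ path (@adj T) x p, last x p = y &
      forall q, path (@adj T) x q -> last x q = y -> (size p <= size q)%N].

Definition path_edges (x : T) (p : seq T) : seq (T * T) := zip (x :: p) p.

Definition common_edge (x : T) (p : seq T) (y : T) (q : seq T) : Prop :=
  exists u v, (u, v) \in path_edges x p /\
    ((u, v) \in path_edges y q \/ (v, u) \in path_edges y q).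

Definition quartet (x1 x2 y1 y2 : T) : Prop :=
  uniq [:: x1; x2; y1; y2] /\
  exists p q, [/\ shortest_path x1 x2 p, shortest_path y1 y2 q &
                  common_edge x1 p y1 q].

End TreeInvariants.

(** * Finite sets with a quaternary relation *)

Record qstruct := QStruct {
  qcarrier :> finType;
  qrel : qcarrier -> qcarrier -> qcarrier -> qcarrier -> bool
}.

Definition is_embedding (X Y : qstruct) (f : {ffun X -> Y}) : bool :=
  injectiveb f &&
  [forall x1, forall x2, forall y1, forall y2,
     qrel (f x1) (f x2) (f y1) (f y2) == qrel x1 x2 y1 y2].

Record embedding (X Y : qstruct) := Embedding {
  emb_fun :> {ffun X -> Y};
  embP : is_embedding emb_fun
}.

HB.instance Definition _ (X Y : qstruct) := [isSub for @emb_fun X Y].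

Lemma is_embeddingP (X Y : qstruct) (f : {ffun X -> Y}) :
  reflect (injective f /\ forall x1 x2 y1 y2,
             qrel (f x1) (f x2) (f y1) (f y2) = qrel x1 x2 y1 y2)
          (is_embedding f).
Proof.
apply: (iffP andP) => -[fI fR]; split; try exact/injectiveP.
  move=> x1 x2 y1 y2; apply/eqP.
  by move/forallP/(_ x1)/forallP/(_ x2)/forallP/(_ y1)/forallP/(_ y2): fR.
by do 4!apply/forallP => ?; rewrite fR.
Qed.

Lemma is_embedding_comp (X Y Z : qstruct) (g : embedding Y Z)
  (f : embedding X Y) : is_embedding [ffun x => g (f x)].
Proof.
have [[gI gR] [fI fR]] := (is_embeddingP _ (embP g), is_embeddingP _ (embP f)).
apply/is_embeddingP; split=> [x y|x1 x2 y1 y2]; rewrite !ffunE.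
  by move/gI/fI.
by rewrite gR fR.
Qed.

Definition emb_comp (X Y Z : qstruct) (g : embedding Y Z) (f : embedding X Y) :
  embedding X Z := Embedding (is_embedding_comp g f).

Definition is_iso (X Y : qstruct) (f : embedding X Y) : Prop := bijective f.

Definition qempty : qstruct := @QStruct void (fun _ _ _ _ => false).

Lemma is_embedding_from_empty (X : qstruct) :
  is_embedding (X := qempty) [ffun x => of_void X x].
Proof. by apply/is_embeddingP; split; case. Qed.

Definition from_empty (X : qstruct) : embedding qempty X :=
  Embedding (is_embedding_from_empty X).

Definition qdel (X : qstruct) (a : X) : qstruct :=
  @QStruct {x : X | x != a}
    (fun x1 x2 y1 y2 => qrel (val x1) (val x2) (val y1) (val y2)).

Lemma is_embedding_del (X : qstruct) (a : X) :
  is_embedding (X := qdel a) [ffun x => val x].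
Proof.
apply/is_embeddingP; split=> [x y|x1 x2 y1 y2]; rewrite !ffunE //.
exact: val_inj.
Qed.

Definition del_emb (X : qstruct) (a : X) : embedding (qdel a) X :=
  Embedding (is_embedding_del a).

(** * Tree structures *)

Definition leaf_struct (T : tree) : qstruct :=
  @QStruct {x : T | is_leaf x}
    (fun x1 x2 y1 y2 => `[< quartet (val x1) (val x2) (val y1) (val y2) >]).

Definition tree_structure (X : qstruct) : Prop :=
  #|X| = 0%N \/ exists (T : tree) (f : embedding X (leaf_struct T)), is_iso f.

(** * Amalgamations and measures *)

Record amalgamation (X Y1 Y2 : qstruct)
    (f1 : embedding X Y1) (f2 : embedding X Y2) := Amalgamation {
  am_struct : qstruct;
  am_tree : tree_structure am_struct;
  am_emb1 : embedding Y1 am_struct;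
  am_emb2 : embedding Y2 am_struct;
  am_comm : emb_comp am_emb1 f1 = emb_comp am_emb2 f2;
  am_surj : forall z : am_struct,
    (exists y, am_emb1 y = z) \/ (exists y, am_emb2 y = z)
}.

Definition am_iso (X Y1 Y2 : qstruct) (f1 : embedding X Y1)
    (f2 : embedding X Y2) (A B : amalgamation f1 f2) : Prop :=
  exists h : embedding (am_struct A) (am_struct B),
    [/\ is_iso h, emb_comp h (am_emb1 A) = am_emb1 B &
        emb_comp h (am_emb2 A) = am_emb2 B].

(* A function on embeddings is defined on all quaternary structures, but only
   its values on embeddings between tree structures are constrained (or used):
   values elsewhere are junk.  In [measure_amalg], the finite family [A] is a
   system of representatives of the isomorphism classes of amalgamations. *)
Record is_measure (R : comPzRingType)
    (mu : forall X Y : qstruct, embedding X Y -> R) : Prop := IsMeasure {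
  measure_iso : forall (X Y : qstruct) (f : embedding X Y),
    tree_structure X -> tree_structure Y -> is_iso f -> mu X Y f = 1;
  measure_comp : forall (X Y Z : qstruct) (j : embedding Y Z)
      (i : embedding X Y),
    tree_structure X -> tree_structure Y -> tree_structure Z ->
    mu X Z (emb_comp j i) = mu Y Z j * mu X Y i;
  measure_amalg : forall (X Y X' : qstruct) (i : embedding X Y)
      (j : embedding X X') (I : finType) (A : I -> amalgamation i j),
    tree_structure X -> tree_structure Y -> tree_structure X' ->
    (forall B : amalgamation i j, exists! a : I, am_iso B (A a)) ->
    mu X Y i = \sum_(a : I) mu X' (am_struct (A a)) (am_emb2 (A a))
}.

Definition mu_tree (R : Type) (mu : forall X Y : qstruct, embedding X Y -> R)
  (T : tree) : R := mu _ _ (from_empty (leaf_struct T)).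

Definition mu_marked (R : Type) (mu : forall X Y : qstruct, embedding X Y -> R)
  (T : tree) (a : leaf_struct T) : R := mu _ _ (del_emb a).

(** * The ring Z[tau, (tau - 1)^-1], as a subring of the field Z(tau) *)

Definition Ztau_mem : {pred {fraction {poly int}}} :=
  fun x => `[< exists (p : {poly int}) (n : nat),
                 x = tofrac p / tofrac ('X - 1) ^+ n >].

Lemma Xsub1_neq0 : tofrac ('X - 1 : {poly int}) != 0.
Proof. by rewrite tofrac_eq0 -polyC1 polyXsubC_eq0. Qed.

Lemma Ztau_subring : subring_closed Ztau_mem.
Proof.
rewrite /Ztau_mem; move: ('X - 1 : {poly int}) Xsub1_neq0 => s s0.
have nz n : tofrac s ^+ n != 0 by rewrite expf_neq0.
split=> [|x y|x y].
- by apply/asboolP; exists 1, 0%N; rewrite expr0 divr1 tofrac1.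
- move=> /asboolP[p [n ->]] /asboolP[q [m ->]]; apply/asboolP.
  exists (p * s ^+ m - q * s ^+ n), (n + m)%N.
  by rewrite tofracB !tofracM !tofracXn -mulNr addf_div ?nz // mulNr exprD.
- move=> /asboolP[p [n ->]] /asboolP[q [m ->]]; apply/asboolP.
  by exists (p * q), (n + m)%N; rewrite tofracM exprD mulf_div.
Qed.

HB.instance Definition _ :=
  GRing.isSubringClosed.Build {fraction {poly int}} Ztau_mem Ztau_subring.

Record Ztau := MkZtau {
  Ztau_val : {fraction {poly int}};
  Ztau_valP : Ztau_val \in Ztau_mem
}.

HB.instance Definition _ := [isSub for Ztau_val].
HB.instance Definition _ := [Choice of Ztau by <:].
HB.instance Definition _ := [SubChoice_isSubComNzRing of Ztau by <:].

Definition Ztau_unit : {pred Ztau} :=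
  fun x => (val x != 0) && ((val x)^-1 \in Ztau_mem).

Definition Ztau_inv (x : Ztau) : Ztau := insubd x (val x)^-1.

Lemma Ztau_mulVx : {in Ztau_unit, left_inverse 1 Ztau_inv *%R}.
Proof.
move=> x /andP[x0 xV]; apply: val_inj.
by rewrite rmorphM rmorph1 /= val_insubd xV mulVf.
Qed.

Lemma Ztau_unitPl (x y : Ztau) : y * x = 1 -> Ztau_unit x.
Proof.
move=> /(congr1 val) yx1; have {}yx1 : val y * val x = 1 by exact: yx1.
have x0 : val x != 0.
  by apply/eqP => x0; move/eqP: yx1; rewrite x0 mulr0 eq_sym oner_eq0.
rewrite /Ztau_unit x0 /=.
suff -> : (val x)^-1 = val y by exact: valP.
by rewrite -[LHS]mul1r -yx1 mulfK.
Qed.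

Lemma Ztau_inv_out : {in [predC Ztau_unit], Ztau_inv =1 id}.
Proof.
move=> x; rewrite inE /= => xU; apply: val_inj; rewrite val_insubd.
case: ifPn => // xV; move: xU; rewrite unfold_in xV andbT negbK => /eqP ->.
by rewrite invr0.
Qed.

HB.instance Definition _ :=
  GRing.ComNzRing_hasMulInverse.Build Ztau Ztau_mulVx Ztau_unitPl Ztau_inv_out.

Lemma tau_subproof : tofrac ('X : {poly int}) \in Ztau_mem.
Proof. by apply/asboolP; exists 'X, 0%N; rewrite expr0 divr1. Qed.

Definition tau : Ztau := MkZtau tau_subproof.

Lemma tau_sub1_unit : tau - 1 \is a GRing.unit.
Proof.
have E : val (tau - 1) = tofrac ('X - 1 : {poly int}).
  by rewrite rmorphB rmorph1 /= tofracB tofrac1.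
apply/andP; rewrite E Xsub1_neq0; split=> //.
by apply/asboolP; exists 1, 1%N; rewrite tofrac1 expr1 mul1r.
Qed.

Definition tau_falling (n : nat) : Ztau := \prod_(2 <= j < n) (tau - j%:R).

(** * The measure mu_tau *)

Definition is_star (m : nat) (T : tree) : Prop :=
  exists x : T, (forall y, is_node y <-> y = x) /\ leaves_at x = m.

Definition is_Y (T : tree) : Prop :=
  exists x y : T, [/\ adj x y, forall z, is_node z <-> (z = x \/ z = y),
    leaves_at x = 2%N & leaves_at y = 2%N].

Definition is_Z (T : tree) (a : T) : Prop :=
  exists x y z : T,
    [/\ uniq [:: x; y; z], adj x y /\ adj y z,
        forall w, is_node w <-> [\/ w = x, w = y | w = z],
        [/\ leaves_at x = 2%N, leaves_at y = 1%N & leaves_at z = 2%N] &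
        adj y a].

Record is_mu_tau (mu : forall X Y : qstruct, embedding X Y -> Ztau) : Prop :=
  IsMuTau {
  mu_tau_measure : is_measure mu;
  mu_tau_X1 : forall (T : tree) (a : leaf_struct T),
    reduced T -> nleaves T = 1%N -> mu_marked mu a = tau / (tau - 1);
  mu_tau_X2 : forall (T : tree) (a : leaf_struct T),
    reduced T -> nleaves T = 2%N -> mu_marked mu a = 1 / (tau - 1);
  mu_tau_Xm : forall (m : nat) (T : tree) (a : leaf_struct T),
    (4 <= m)%N -> is_star m T ->
    mu_marked mu a = (tau + 1 - m%:R) / (tau - 1);
  mu_tau_X3 : forall (T : tree) (a : leaf_struct T),
    is_star 3 T -> mu_marked mu a = - ((tau - 2%:R) / (tau - 1));
  mu_tau_Y : forall (T : tree) (a : leaf_struct T),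
    is_Y T -> mu_marked mu a = - ((tau - 2%:R) / (tau - 1));
  mu_tau_Z : forall (T : tree) (a : leaf_struct T),
    is_Z (val a) -> mu_marked mu a = - ((tau - 2%:R) / (tau - 1))
}.

(* Main.v *)
Require Import Defs.
From mathcomp Require Import all_boot all_order all_algebra.
From mathcomp Require Import boolp zify ring.

(** The value of [mu] on a tree is found by deleting leaves one at a time.
    Multiplicativity gives mu(T) = mu(T, a) mu(T \ a) for any leaf a, so it
    suffices to know mu(T, a) for one well-chosen leaf of each reduced tree.
    Take a adjacent to an end node x, that is, a node with at most one
    neighbour y that is not a leaf ([end_node_exists]), and let m be the
    valence of x.  If T has no other node it is a star, and mu(T, a) is
    prescribed.  Otherwise y is a node, and T \ a -> T is the only
    amalgamation of T \ a with a prescribed marked tree, whence the two have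
    the same measure ([mu_marked_transfer]).

    - If m >= 4, the prescribed marked tree is the star X_m, whose leaves are
      those adjacent to x and one leaf c beyond y: since the m - 1 >= 3 leaves
      other than a already determine the node x in T \ a, the leaf a can only
      be attached at x ([mu_marked_bush]).
    - If m = 3, let b be the other leaf at x, and let c, d be leaves in two
      different branches beyond y.  The prescribed tree is Y, with cherries
      {a, b} and {c, d}.  In T \ a nothing branches off between b and y, so a
      can only be attached in the middle of that edge ([mu_marked_cherry]).

    Uniqueness of amalgamations is proved without drawing trees.  The
    quaternary relation of leaves is interdefinable with the relation ab|cd,
    meaning that some edge separates a, b from c, d; this relation satisfies
    the axioms of [treelike], and a structure obtained by adding a leaf a is
    determined by the splits au|vw.  Under the hypotheses above these axioms
    force all of them ([cherry_attachment], [star_attachment]).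

    The tree T \ a is obtained by removing the vertex a.  When m = 3 this leaves
    x with valence two; removing b as well makes x a leaf, which takes over the
    role of b ([delete_leaf_smooth_iso]), and the tree is reduced again.  The
    claimed formula is the product over all vertices of a factor depending on
    the valence ([node_factor]), times tau / (tau - 1) ^ l.  Deleting a changes
    only the factor of x, so the formula satisfies the same recursion as [mu]
    ([mu_tree_formula]). *)

Set Implicit Arguments.
Unset Strict Implicit.
Unset Printing Implicit Defensive.

Import GRing.Theory.
Local Open Scope ring_scope.

(** * Edges of a tree and the splits they induce *)

Lemma connect_ind (V : finType) (e : rel V) u (P : V -> Prop) :
  P u -> (forall p q, P p -> e p q -> P q) -> forall z, connect e u z -> P z.
Proof.
move=> Pu Pe z /connectP[p pth ->] {z}.
elim: p u Pu pth => //= q p IH u Pu /andP[uq]; apply: IH; exact: Pe uq.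
Qed.

Section Sides.
Variable T : tree.
Implicit Types (u v w x y z : T).

(** The tree with the edge between [u] and [v] removed; [side u v] is then
    the component of [u]. *)
Definition cut u v : rel T :=
  [rel p q | adj p q && ((p, q) \notin [:: (u, v); (v, u)])].

Definition side u v : {set T} := [set z | connect (cut u v) u z].

Lemma cutC u v : cut u v =2 cut v u.
Proof. by move=> p q; rewrite /cut /= !inE orbC. Qed.

Lemma cut_sym u v : symmetric (cut u v).
Proof.
move=> p q; rewrite /cut /= adj_sym !inE !xpair_eqE.
by congr (_ && ~~ _); rewrite orbC; congr (_ || _); rewrite andbC.
Qed.

Lemma cut_connect_sym u v : connect_sym (cut u v).
Proof. exact/sym_connect_sym/cut_sym. Qed.

Lemma side_refl u v : u \in side u v.
Proof. by rewrite inE. Qed.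

Lemma side_step u v p q : cut u v p q -> (p \in side u v) = (q \in side u v).
Proof.
move=> pq; rewrite !inE.
by apply: (same_connect_r (@cut_connect_sym u v)); apply: connect1.
Qed.

Lemma cut_uniq_path u v p :
  path (@adj T) v p -> u \notin v :: p -> connect (cut u v) v (last v p).
Proof.
suff: forall w, path (@adj T) w p -> u \notin w :: p ->
     connect (cut u v) w (last w p) by apply.
elim: p => //= q p IH w /andP[wq pth]; rewrite !inE !negb_or => /and3P[uw uq up].
apply: (@connect_trans _ _ q); last by apply: IH => //; rewrite inE negb_or uq.
by apply: connect1; rewrite /cut /= wq !inE !xpair_eqE
  [w == u]eq_sym (negPf uw) [q == u]eq_sym (negPf uq) andbF.
Qed.

(** This is where acyclicity enters: a path from [u] to [v] avoiding the edge
    between them would close up to a cycle of length at least 3. *)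
Lemma sideNr u v : adj u v -> v \notin side u v.
Proof.
move=> uv; apply/negP; rewrite inE => /connectP[p0 pth0 ev].
case: (shortenP pth0) ev => p pth up _ ev {p0 pth0}.
have cuv : cut u v (last u p) u = false.
  by rewrite -ev /cut /= !inE eqxx orbT andbF.
have ap : path (@adj T) u p by apply: sub_path pth => i j /andP[].
case: p pth up ev cuv ap => [_ _ /= vu|q p pth up ev cuv ap].
  by rewrite vu adj_irr in uv.
have := @tree_acyclic T (u :: q :: p); rewrite /ucycle up andbT /=.
rewrite rcons_path -(last_cons u q p) -ev [adj v u]adj_sym uv andbT.
case: p pth up ev cuv ap => [|q' p] pth up ev cuv ap.
  move: pth ev => /= + vq; rewrite -vq /cut /= !inE eqxx /=.
  by rewrite andbF.
by move/(_ ap).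
Qed.

Lemma sideC u v : adj u v -> side v u = ~: side u v.
Proof.
move=> uv; have dis z : z \in side u v -> z \notin side v u.
  move=> zu; apply/negP => zv.
  have := sideNr uv; rewrite inE => /negP; apply.
  rewrite !inE in zu zv; apply: connect_trans zu _.
  by rewrite cut_connect_sym (eq_connect (@cutC u v)).
apply/setP=> z; rewrite in_setC; apply/idP/idP; first by apply: contraL; apply: dis.
apply: contraR.
apply: (@connect_ind _ (@adj T) u (fun z => z \notin side v u -> z \in side u v));
  last exact: tree_connected.
- by rewrite side_refl.
- move=> p q IH pq.
  have [e|ne] := boolP ((p, q) \in [:: (u, v); (v, u)]).
    move: e; rewrite !inE !xpair_eqE => /orP[]/andP[/eqP ep /eqP eq]; subst p q.
      by rewrite connect0.
    by move=> _; rewrite connect0.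
  have cpq : cut u v p q by rewrite /cut /= pq.
  have cpq' : cut v u p q by rewrite cutC.
  by rewrite -(side_step cpq) -(side_step cpq').
Qed.

Lemma side_adj u v p q : adj u v -> adj p q -> p \in side u v -> q \notin side u v ->
  p = u /\ q = v.
Proof.
move=> uv pq pu qu.
have [e|ne] := boolP ((p, q) \in [:: (u, v); (v, u)]); last first.
  have cpq : cut u v p q by rewrite /cut /= pq.
  by rewrite -(side_step cpq) pu in qu.
move: e; rewrite !inE !xpair_eqE => /orP[]/andP[/eqP ep /eqP eq]; subst p q => //.
by rewrite (negPf (sideNr uv)) in pu.
Qed.

(** A component of the tree minus one edge is connected by paths inside it, so
    any other edge that is not contained in it leaves it on one side. *)
Lemma side_connected u v u' v' : adj u' v' ->
  (u' \notin side u v) || (v' \notin side u v) ->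
  {in side u v &, forall p q, (p \in side u' v') = (q \in side u' v')}.
Proof.
move=> uv' out.
suff H p : p \in side u v -> (p \in side u' v') = (u \in side u' v').
  by move=> p q /H -> /H ->.
rewrite inE => up; suff: p \in side u v /\ (p \in side u' v') = (u \in side u' v')
  by case.
move: p up; apply: connect_ind; first by rewrite side_refl.
move=> p q [pu <-] pq; have qu : q \in side u v by rewrite -(side_step pq).
split=> //; symmetry; apply: side_step; case/andP: pq => pq _.
rewrite /cut /= pq /= !inE !xpair_eqE; apply/negP => /orP[]/andP[/eqP e1 /eqP e2];
 by subst p q; rewrite pu qu in out.
Qed.

(** Moving away from [y] along two consecutive edges, the far sides shrink; this
    drives the inductions that look for leaves and end nodes. *)
Lemma side_nest y w w' : adj y w -> adj w w' -> w' != y ->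
  side w' w \proper side w y.
Proof.
move=> yw ww' w'y; have w'w : adj w' w by rewrite adj_sym.
have wy : adj w y by rewrite adj_sym.
have wN := sideNr w'w.
apply/properP; split; last by exists w; rewrite ?side_refl.
apply/subsetP => z zS.
rewrite (side_connected wy _ zS (side_refl _ _)) ?wN //.
have c : cut w y w w'.
  rewrite /cut /= ww' !inE !xpair_eqE eqxx (negPf w'y) /=.
  by apply/negP => /andP[_ /eqP e]; rewrite e adj_irr in ww'.
by rewrite -(side_step c) side_refl.
Qed.

(** The split written ab|cd below. *)
Definition separates (a b c d : T) : Prop :=
  exists u v, [/\ adj u v, a \in side u v, b \in side u v,
                  c \notin side u v & d \notin side u v].

Lemma separates_swap a b c d : separates a b c d -> separates b a c d.
Proof. by move=> [u [v [? ? ? ? ?]]]; exists u, v. Qed.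

Lemma separates_flip a b c d : separates a b c d -> separates c d a b.
Proof.
move=> [u [v [uv au bu cu du]]]; exists v, u.
by rewrite adj_sym sideC // !in_setC cu du !negbK; split.
Qed.

(** Two edges inducing ab|cd and ac|bd would cross: one side of the first edge
    is not cut by the second, hence cannot be split by it. *)
Lemma separates_excl a b c d : separates a b c d -> ~ separates a c b d.
Proof.
move=> [u [v [uv au bu cu du]]] [u' [v' [uv' au' cu' bu' du']]].
have [//|i] := boolP ((u' \notin side u v) || (v' \notin side u v)).
  move=> out; have := side_connected uv' out au bu.
  by rewrite au' (negPf bu').
have out : (u' \notin side v u) || (v' \notin side v u).
  by rewrite sideC // !in_setC; case/norP: i => ->.
have := @side_connected v u u' v' uv' out c d.
by rewrite cu' (negPf du') sideC // !in_setC cu du => /(_ isT isT).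
Qed.

Lemma separates_subst a b c d e : separates a b c d ->
  (separates a e c d /\ separates b e c d) \/ (separates a b c e /\ separates a b d e).
Proof.
move=> [u [v [uv au bu cu du]]]; have [eu|eu] := boolP (e \in side u v).
  by left; split; exists u, v.
by right; split; exists u, v.
Qed.

Lemma path_edges_mem x p u v : path (@adj T) x p -> (u, v) \in path_edges x p ->
  [/\ adj u v, u \in x :: p & v \in x :: p].
Proof.
elim: p x => //= y p IH x /andP[xy /IH h]; rewrite /path_edges /= inE.
case/orP=> [/eqP[-> ->]|/h[-> hu hv]]; first by rewrite !inE !eqxx orbT.
by rewrite in_cons hu [v \in _]in_cons hv !orbT.
Qed.

Lemma path_edges_side x p u v : path (@adj T) x p -> uniq (x :: p) ->
  (u, v) \in path_edges x p -> x \in side u v /\ last x p \notin side u v.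
Proof.
elim: p x => //= y p IH x /andP[xy pth] /andP[xp up].
have [hx hp] : adj x y /\ uniq (y :: p) by [].
rewrite /path_edges /= inE => /orP[/eqP[-> ->]|uvp].
  split; first exact: side_refl.
  have := sideC xy => /setP/(_ (last y p)); rewrite in_setC => <-.
  by rewrite inE -(eq_connect (@cutC x y)) cut_uniq_path.
have [yu ->] := IH _ pth hp uvp; split=> //.
have [_ ui vi] := path_edges_mem pth uvp.
rewrite (side_step (q := y)) // /cut /= xy !inE !xpair_eqE.
by apply/negP => /orP[]/andP[/eqP e _]; rewrite e ?ui ?vi in xp.
Qed.

Lemma separated_path_edge x p u v : path (@adj T) x p ->
  (x \in side u v) != (last x p \in side u v) ->
  (u, v) \in path_edges x p \/ (v, u) \in path_edges x p.
Proof.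
elim: p x => [|y p IH] x /=; first by rewrite eqxx.
move=> /andP[xy pth] sep; rewrite /path_edges /= !inE.
have [e|ne] := boolP ((x, y) \in [:: (u, v); (v, u)]).
  by move: e; rewrite !inE => /orP[]/eqP ->; rewrite eqxx; [left | right].
have c : cut u v x y by rewrite /cut /= xy.
rewrite (side_step c) in sep.
by case: (IH _ pth sep) => h; [left|right]; rewrite h orbT.
Qed.

Lemma shortest_path_exists x y : exists p, shortest_path x y p.
Proof.
pose P n := `[< exists p, [/\ path (@adj T) x p, last x p = y & size p = n] >].
have exP : exists n, P n.
  case/connectP: (tree_connected x y) => p pth e.
  by exists (size p); apply/asboolP; exists p.
case: (ex_minnP exP) => n /asboolP[p [pth e s]] min.
exists p; split=> // q qp qe; rewrite s; apply: min; apply/asboolP.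
by exists q.
Qed.

Lemma shortest_path_uniq x y p : shortest_path x y p -> uniq (x :: p).
Proof.
case=> pth e min; move: min; rewrite -e.
case: (shortenP pth) => q qp qu sub min.
have sub' : {subset x :: q <= x :: p}.
  by move=> z; rewrite !in_cons => /orP[-> //|/sub ->]; rewrite orbT.
by apply: (leq_size_uniq qu sub'); rewrite /= ltnS min.
Qed.

(** The paths joining x1, x2 and y1, y2 share an edge exactly when an edge
    separates both pairs, since the edges of a shortest path are precisely those
    separating its end points. *)
Lemma quartetP x1 x2 y1 y2 : quartet x1 x2 y1 y2 <->
  uniq [:: x1; x2; y1; y2] /\ (separates x1 y1 x2 y2 \/ separates x1 y2 x2 y1).
Proof.
split=> -[un H]; split=> //.
  case: H => p [q [sp sq [u [v [uvp uvq]]]]].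
  have [up uq] := (shortest_path_uniq sp, shortest_path_uniq sq).
  case: sp sq => [pp lp _] [pq lq _].
  have [x1u] := path_edges_side pp up uvp; rewrite lp => x2u.
  have [uv _ _] := path_edges_mem pp uvp.
  have vu : adj v u by rewrite adj_sym.
  case: uvq => /(path_edges_side pq uq); rewrite lq => -[yu1 yu2].
    by left; exists u, v.
  right; exists u, v; move: yu1 yu2.
  by rewrite sideC // !in_setC negbK; split.
have [p sp] := shortest_path_exists x1 x2.
have [q sq] := shortest_path_exists y1 y2.
exists p, q; split=> //; case: sp sq => [pp lp _] [pq lq _].
have [u [v [uv s1 s2]]] : exists u v, [/\ adj u v,
    (x1 \in side u v) != (x2 \in side u v) & (y1 \in side u v) != (y2 \in side u v)].
  by case: H => -[u [v [uv h1 h2 h3 h4]]]; exists u, v;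
    rewrite h1 h2 (negPf h3) (negPf h4).
rewrite -lp in s1; rewrite -lq in s2.
have h1 := separated_path_edge pp s1.
have h2 := separated_path_edge pq s2.
case: h1 => h1; [exists u, v | exists v, u]; split=> //.
by case: h2; [right|left].
Qed.

End Sides.

(** * The split relation of a quaternary structure *)

(** By [quartetP], the relation on (a, c; b, d) means ab|cd or ad|cb, and on
    (a, d; b, c) it means ab|cd or ac|db; incompatible splits cannot hold
    together, so the conjunction recovers ab|cd ([qsplitP]). *)
Definition qsplit (X : qstruct) (a b c d : X) : bool :=
  qrel a c b d && qrel a d b c.

(** The properties of splits by edges that the argument uses.  The substitution
    axiom says that a fifth point lies on one of the two sides of an edge. *)
Record treelike (X : qstruct) : Prop := Treelike {
  treelike_rel : forall x1 x2 y1 y2 : X,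
    qrel x1 x2 y1 y2 = qsplit x1 y1 x2 y2 || qsplit x1 y2 x2 y1;
  treelike_uniq : forall a b c d : X, qsplit a b c d -> uniq [:: a; b; c; d];
  treelike_swap : forall a b c d : X, qsplit a b c d = qsplit b a c d;
  treelike_flip : forall a b c d : X, qsplit a b c d = qsplit c d a b;
  treelike_excl : forall a b c d : X, qsplit a b c d -> ~~ qsplit a c b d;
  treelike_subst : forall a b c d e : X, qsplit a b c d ->
    e \notin [:: a; b; c; d] ->
    (qsplit a e c d && qsplit b e c d) || (qsplit a b c e && qsplit a b d e)
}.

Lemma emb_inj (X Y : qstruct) (f : embedding X Y) : injective f.
Proof. by case/is_embeddingP: (embP f). Qed.

Lemma emb_rel (X Y : qstruct) (f : embedding X Y) x1 x2 y1 y2 :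
  qrel (f x1) (f x2) (f y1) (f y2) = qrel x1 x2 y1 y2.
Proof. by case/is_embeddingP: (embP f). Qed.

Lemma emb_split (X Y : qstruct) (f : embedding X Y) a b c d :
  qsplit (f a) (f b) (f c) (f d) = qsplit a b c d.
Proof. by rewrite /qsplit !emb_rel. Qed.

Lemma emb_eq (X Y : qstruct) (f g : embedding X Y) : f =1 g -> f = g.
Proof. by move=> fg; apply/val_inj/ffunP. Qed.

Lemma emb_compE (X Y Z : qstruct) (g : embedding Y Z) (f : embedding X Y) x :
  emb_comp g f x = g (f x).
Proof. by rewrite ffunE. Qed.

Lemma treelike_emb (X Y : qstruct) (f : embedding X Y) :
  treelike Y -> treelike X.
Proof.
move=> H; split=> [x1 x2 y1 y2|a b c d|a b c d|a b c d|a b c d|a b c d e];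
  rewrite -!(emb_split f).
- by rewrite -(emb_rel f); apply: treelike_rel.
- by move/(treelike_uniq H); rewrite -(map_inj_uniq (@emb_inj _ _ f)).
- exact: treelike_swap.
- exact: treelike_flip.
- exact: treelike_excl.
- move/(treelike_subst H) => h e'; apply: h.
  by rewrite -(mem_map (@emb_inj _ _ f)) in e'.
Qed.

Lemma leaf_quartetP (T : tree) (a b c d : leaf_struct T) :
  reflect (uniq [:: a; b; c; d] /\
     (separates (val a) (val c) (val b) (val d) \/ separates (val a) (val d) (val b) (val c)))
    (qrel a b c d).
Proof.
rewrite -(map_inj_uniq val_inj).
rewrite [qrel _ _ _ _]/(`[< _ >]).
by apply: (iffP (asboolP _)) => /quartetP.
Qed.

Lemma qsplitP (T : tree) (a b c d : leaf_struct T) :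
  reflect (uniq [:: a; b; c; d] /\ separates (val a) (val b) (val c) (val d))
    (qsplit a b c d).
Proof.
have swapr p q r s : separates p q r s -> separates p q s r :> Prop.
  by move/separates_flip/separates_swap/separates_flip.
have u1 : uniq [:: a; b; c; d] = uniq [:: a; c; b; d].
  by apply: perm_uniq; rewrite perm_cons (permEl (perm_catCA [:: b] [:: c] [:: d])).
have u2 : uniq [:: a; b; c; d] = uniq [:: a; d; b; c].
  by apply: perm_uniq; rewrite perm_cons (permEl (perm_catC [:: b; c] [:: d])).
apply: (iffP andP) => [[/leaf_quartetP[u h1] /leaf_quartetP[_ h2]]|[u h]].
  split; first by rewrite u1.
  case: h1 => // h1; case: h2 => [/swapr//|h2].
  by case: (separates_excl h1 h2).
split; apply/leaf_quartetP; first by rewrite -u1; split=> //; left.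
by rewrite -u2; split=> //; left; apply: swapr.
Qed.

Lemma treelike_leaf_struct (T : tree) : treelike (leaf_struct T).
Proof.
split=> [x1 x2 y1 y2|a b c d|a b c d|a b c d|a b c d|a b c d e].
- have u1 : uniq [:: x1; x2; y1; y2] = uniq [:: x1; y1; x2; y2].
    by apply: perm_uniq; rewrite perm_cons (permEl (perm_catCA [:: x2] [:: y1] [:: y2])).
  have u2 : uniq [:: x1; x2; y1; y2] = uniq [:: x1; y2; x2; y1].
    by apply: perm_uniq; rewrite perm_cons (permEl (perm_catC [:: x2; y1] [:: y2])).
  apply/leaf_quartetP/orP => [[u []]h|[]/qsplitP[u h]].
  + by left; apply/qsplitP; rewrite -u1.
  + by right; apply/qsplitP; rewrite -u2.
  + by rewrite u1; split=> //; left.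
  + by rewrite u2; split=> //; right.
- by case/qsplitP.
- have u1 : uniq [:: a; b; c; d] = uniq [:: b; a; c; d].
    by apply: perm_uniq; rewrite (permEl (perm_catCA [:: a] [:: b] [:: c; d])).
  by apply/qsplitP/qsplitP; rewrite u1 => -[? /separates_swap].
- have u1 : uniq [:: a; b; c; d] = uniq [:: c; d; a; b].
    by apply: perm_uniq; rewrite (permEl (perm_catC [:: a; b] [:: c; d])).
  by apply/qsplitP/qsplitP; rewrite u1 => -[? /separates_flip].
- case/qsplitP=> _ h; apply/qsplitP => -[_ h'].
  exact: separates_excl h h'.
- case/qsplitP=> u h; rewrite !inE !negb_or => /and4P[ea eb ec ed].
  move: u; rewrite /= !inE !negb_or => /and4P[/and3P[ab ac ad] /andP[bc bd] cd _].
  by case: (separates_subst (val e) h) => -[h1 h2]; apply/orP; [left|right];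
    apply/andP; split; apply/qsplitP; split=> //;
    rewrite /= !inE !negb_or ?[a == e]eq_sym ?[b == e]eq_sym ?[c == e]eq_sym
      ?[d == e]eq_sym ?ab ?ac ?ad ?bc ?bd ?cd ?ea ?eb ?ec ?ed.
Qed.

Lemma treelike_tree_structure (X : qstruct) : tree_structure X -> treelike X.
Proof.
case=> [X0|[T [f _]]]; last exact: treelike_emb (treelike_leaf_struct T).
have F (x : X) : False by have := card0_eq X0 x.
by split=> a; case: (F a).
Qed.

(** * Deleting a leaf *)

Lemma inj_surj_bij (A B : finType) (f : A -> B) :
  injective f -> (forall y, exists x, f x = y) -> bijective f.
Proof.
move=> fi fs; have fs' y : exists x, f x == y by have [x <-] := fs y; exists x.
exists (fun y => xchoose (fs' y)) => [x|y]; last exact/eqP/(xchooseP (fs' y)).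
by apply: fi; apply/eqP; exact: (xchooseP (fs' (f x))).
Qed.

Lemma is_embedding_split (X Y : qstruct) (f : X -> Y) :
  treelike X -> treelike Y -> injective f ->
  (forall a b c d, uniq [:: a; b; c; d] ->
     qsplit (f a) (f b) (f c) (f d) = qsplit a b c d) ->
  is_embedding [ffun x => f x].
Proof.
move=> HX HY fi fs; apply/is_embeddingP; split=> [x y|x1 x2 y1 y2].
  by rewrite !ffunE => /fi.
have fs' a b c d : qsplit (f a) (f b) (f c) (f d) = qsplit a b c d.
  have [/fs//|un] := boolP (uniq [:: a; b; c; d]).
  rewrite [RHS](contraNF (treelike_uniq HX (d := d)) un).
  by rewrite -(map_inj_uniq fi) in un; exact: (contraNF (treelike_uniq HY (d := f d)) un).
by rewrite !ffunE (treelike_rel HX) (treelike_rel HY) !fs'.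
Qed.

Section Valence.
Variable T : tree.

Lemma valence_gt0 (z : T) : (1 < #|T|)%N -> (0 < valence z)%N.
Proof.
rewrite (cardD1 z) inE ltnS lt0n => /existsP[y] /[!inE] /andP[yz _].
case/connectP: (tree_connected z y) => -[|q p] /=; first by move=> _ e; rewrite e eqxx in yz.
by move=> /andP[zq _] _; apply/card_gt0P; exists q; rewrite inE.
Qed.

Lemma is_leafE (z : T) : (1 < #|T|)%N -> is_leaf z = (valence z == 1%N).
Proof. by rewrite /is_leaf; case: eqP => //= _ ; case: eqP => // ->. Qed.

Lemma valence_lt (z : T) : (valence z < #|T|)%N.
Proof.
rewrite /valence (cardD1 z T) inE ltnS; apply: subset_leq_card.
apply/subsetP => y; rewrite !inE => zy; rewrite andbT.
by apply: contraTneq zy => ->; rewrite adj_irr.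
Qed.

Lemma valence1P (z y : T) : (1 < #|T|)%N -> is_leaf z -> adj z y ->
  forall w, adj z w = (w == y).
Proof.
move=> T1; rewrite is_leafE // => /cards1P[y' e] zy w.
have := in_set1 y y'; rewrite -e inE zy => /esym/eqP ->.
by rewrite -in_set1 -e inE.
Qed.

End Valence.

Section DeleteLeaf.
Variables (T : tree) (a x : T).
Hypothesis adja : forall z, adj a z = (z == x).

Let ax : adj a x. Proof. by rewrite adja. Qed.
Let xa : x != a. Proof. by apply: contraTneq ax => ->; rewrite adj_irr. Qed.
Let adjza z : adj z a = (z == x). Proof. by rewrite adj_sym adja. Qed.

(** Sending the deleted leaf to its neighbour maps edges to edges or to points,
    so it transports connectedness without any manipulation of paths. *)
Definition retract (z : T) : {z : T | z != a} := insubd (exist _ x xa) z.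

Lemma val_retract z : val (retract z) = if z != a then z else x.
Proof. by rewrite val_insubd. Qed.

Lemma retractK (p : {z : T | z != a}) : retract (val p) = p.
Proof. by apply: val_inj; rewrite val_retract (valP p). Qed.

Lemma retract_a : retract a = retract x.
Proof. by apply: val_inj; rewrite !val_retract eqxx xa. Qed.

Let dadj : rel {z : T | z != a} := [rel p q | adj (val p) (val q)].

Lemma connect_retract (e : rel T) (e' : rel {z : T | z != a}) u z :
  (forall p q, e p q -> connect e' (retract p) (retract q)) ->
  connect e u z -> connect e' (retract u) (retract z).
Proof.
move=> H; move: z; apply: connect_ind; first exact: connect0.
by move=> p q up /H; apply: connect_trans.
Qed.

Lemma delete_leaf_connected : forall p q, connect dadj p q.
Proof.
move=> p q; rewrite -(retractK p) -(retractK q).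
apply: connect_retract (tree_connected _ _) => {p q} p q pq.
have [e|pa] := eqVneq p a.
  by move: pq; rewrite e adja retract_a => /eqP ->; rewrite connect0.
have [e|qa] := eqVneq q a.
  by move: pq; rewrite e adjza retract_a => /eqP ->; rewrite connect0.
by apply: connect1; rewrite /dadj /= !val_retract pa qa.
Qed.

Lemma delete_leaf_sym : symmetric dadj.
Proof. by move=> p q; exact: adj_sym. Qed.

Lemma delete_leaf_irr : irreflexive dadj.
Proof. by move=> p; exact: adj_irr. Qed.

Lemma delete_leaf_nonempty : (0 < #|{: {z : T | z != a} }|)%N.
Proof. by apply/card_gt0P; exists (retract x). Qed.

Lemma delete_leaf_acyclic c : ucycle dadj c -> (size c <= 2)%N.
Proof.
move=> /andP[cc uc]; rewrite -(size_map val); apply: tree_acyclic.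
rewrite /ucycle map_inj_uniq ?uc ?andbT; last exact: val_inj.
by case: c cc {uc} => //= p c; rewrite -map_rcons path_map.
Qed.

Definition delete_leaf : tree :=
  Tree delete_leaf_sym delete_leaf_irr delete_leaf_nonempty
    delete_leaf_connected delete_leaf_acyclic.

Lemma side_leaf : side a x = [set a].
Proof.
apply/setP=> z; rewrite in_set1; apply/idP/eqP => [|->]; last exact: side_refl.
rewrite inE; move: z; apply: connect_ind => // p q ->.
by rewrite /cut /= adja => /andP[/eqP ->]; rewrite !inE eqxx.
Qed.

Lemma side_delete_leaf (u v : delete_leaf) z :
  (retract z \in side u v) = (z \in side (val u) (val v)).
Proof.
apply/idP/idP.
  have -> : (z \in side (val u) (val v)) = (val (retract z) \in side (val u) (val v)).
    rewrite val_retract; case: eqVneq => [->|//] /=.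
    apply: side_step; rewrite /cut /= ax /= !inE !xpair_eqE.
    rewrite ![a == _]eq_sym (negPf (valP u : val u != a)).
    by rewrite (negPf (valP v : val v != a)).
  rewrite !inE; move: (retract z).
  apply: (@connect_ind delete_leaf _ _ (fun w => connect _ (val u) (val w))) => [|p q up pq].
    exact: connect0.
  apply: connect_trans up (connect1 _).
  by move: pq; rewrite /cut /= !inE !xpair_eqE -!val_eqE.
rewrite !inE.
have := @connect_retract (cut (val u) (val v)) (cut u v) (val u) z.
rewrite retractK; apply=> {z} p q /andP[pq ne].
have [e|pa] := eqVneq p a.
  by move: pq; rewrite e adja retract_a => /eqP ->; rewrite connect0.
have [e|qa] := eqVneq q a.
  by move: pq; rewrite e adjza retract_a => /eqP ->; rewrite connect0.
apply: connect1; rewrite /cut /= /dadj /= !val_retract pa qa pq /=.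
by move: ne; rewrite !inE !xpair_eqE -!val_eqE /= !val_retract pa qa.
Qed.

(** The edge at [a] only cuts off [a] itself, so it never separates two pairs
    of distinct points; every other edge survives, with the same sides.  Stating
    this for the retracted points covers both ways in which leaves of [T]
    correspond to leaves of the smaller tree. *)
Lemma separates_delete_leaf p q r s : uniq (map retract [:: p; q; r; s]) ->
  separates p q r s <-> separates (T := delete_leaf) (retract p) (retract q) (retract r) (retract s).
Proof.
move=> un.
have pq : p <> q by move=> e; move: un; rewrite /= e !inE eqxx.
have rs : r <> s by move=> e; move: un; rewrite /= e !inE eqxx !andbF.
split=> -[u [v [uv pu qu ru su]]]; last first.
  exists (val u), (val v); rewrite -!side_delete_leaf; split=> //; exact: uv.
have ua : u != a.
  apply/eqP => e; subst u; move: uv; rewrite adja => /eqP e; subst v.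
  by apply: pq; move: pu qu; rewrite side_leaf !inE => /eqP -> /eqP ->.
have va : v != a.
  apply/eqP => e; subst v; move: uv; rewrite adjza => /eqP e; subst u.
  by apply: rs; move: ru su; rewrite sideC // side_leaf !inE !negbK => /eqP -> /eqP ->.
exists (retract u), (retract v); rewrite !side_delete_leaf !val_retract ua va.
by split=> //=; rewrite /dadj /= !val_retract ua va.
Qed.

Lemma valence_delete_leaf (p : delete_leaf) :
  valence (val p) = (valence p + (val p == x))%N.
Proof.
rewrite /valence.
have -> : [set y | adj (val p) y] =
    [set val (y : delete_leaf) | y in [set y | adj p y]] :|:
    (if val p == x then [set a] else set0).
  apply/setP=> y; rewrite !inE; apply/idP/orP => [py|[/imsetP[q]|]].
  - have [e|ya] := eqVneq y a.
      by right; rewrite e adjza in py; rewrite py inE e.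
    left; apply/imsetP; exists (retract y); last by rewrite val_retract ya.
    by rewrite inE /= /dadj /= val_retract ya.
  - by rewrite inE => pq ->.
  - by case: ifP; rewrite inE // => /eqP -> /eqP ->; rewrite adj_sym.
rewrite cardsU card_imset; last exact: val_inj.
have -> : [set val (y : delete_leaf) | y in [set y | adj p y]]
    :&: (if val p == x then [set a] else set0) = set0.
  apply/setP=> y; rewrite !inE; apply/negP => /andP[/imsetP[q _ ->]].
  by case: ifP; rewrite inE // (negPf (valP q : val q != a)).
by rewrite cards0 subn0; case: ifP; rewrite ?cards1 ?cards0.
Qed.

Lemma card_delete_leaf : #|T| = #|delete_leaf|.+1.
Proof.
rewrite [in RHS](card_sig (predC1 a)) /=.
by rewrite -[LHS](cardC (pred1 a)) card1.
Qed.

End DeleteLeaf.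

(** * The leaf structure after a deletion *)

Section DeleteLeafStruct.
Variables (T : tree) (a x : T).
Hypothesis adja : forall z, adj a z = (z == x).
Notation T' := (delete_leaf adja).
Notation ret := (retract adja).

Lemma delete_leaf_split_emb (X : qstruct) (i : embedding X (leaf_struct T))
    (f : X -> leaf_struct T') :
  (forall z, val (f z) = ret (val (i z))) -> injective f ->
  is_embedding [ffun z => f z].
Proof.
move=> fE fi; apply: is_embedding_split => //.
- exact: treelike_emb i (treelike_leaf_struct T).
- exact: treelike_leaf_struct.
move=> p q r s un; rewrite -(emb_split i).
have un' : uniq (map ret (map val (map i [:: p; q; r; s]))).
  have -> : map ret (map val (map i [:: p; q; r; s])) = map val (map f [:: p; q; r; s]).
    by rewrite /= !fE.
  by rewrite (map_inj_uniq val_inj) (map_inj_uniq fi).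
apply/qsplitP/qsplitP; rewrite -[[:: f p; _; _; _]]/(map f [:: p; q; r; s])
  -[[:: i p; _; _; _]]/(map i [:: p; q; r; s])
  (map_inj_uniq fi) (map_inj_uniq (@emb_inj _ _ i)) !fE => -[_ h]; split=> //;
  exact/(separates_delete_leaf un').
Qed.

Hypothesis la : is_leaf a.
Let aL : leaf_struct T := exist _ a la.

Let T1 : (1 < #|T|)%N.
Proof. by rewrite (card_delete_leaf adja) ltnS; apply: tree_nonempty. Qed.

Lemma is_leaf_delete_leaf (p : T') : valence x != 2%N ->
  is_leaf p = is_leaf (val p).
Proof.
move=> x2; have px := valence_delete_leaf p.
have [T2|T2] := eqVneq #|T| 2%N.
  have T'1 : #|T'| = 1%N by apply: succn_inj; rewrite -(card_delete_leaf adja).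
  rewrite /is_leaf T'1 orbT; symmetry.
  by have := valence_lt (val p); have := valence_gt0 (val p) T1; rewrite T2; lia.
have T'1 : (1 < #|T'|)%N by have := card_delete_leaf adja; lia.
rewrite !is_leafE // px; have [e|] := eqVneq (val p) x; last by rewrite addn0.
by rewrite e eqxx in px; rewrite addn1; have := valence_gt0 p T'1; move: x2; rewrite px; lia.
Qed.

(** If the neighbour does not have valence two it does not become a leaf, and
    the leaves of the smaller tree are those of [T] other than [a].  When [T] is
    a single edge the neighbour is a leaf before and after. *)
Lemma delete_leaf_iso : valence x != 2%N ->
  exists f : embedding (qdel aL) (leaf_struct T'), is_iso f.
Proof.
move=> x2.
have vret (z : qdel aL) : val (ret (val (val z))) = val (val z).
  by rewrite val_retract; have := valP z; rewrite -val_eqE /= => ->.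
have lf (z : qdel aL) : is_leaf (ret (val (val z)) : T').
  by rewrite is_leaf_delete_leaf // vret (valP (val z)).
pose f (z : qdel aL) : leaf_struct T' := exist _ (ret (val (val z))) (lf z).
have fi : injective f.
  move=> z w /(congr1 val) /= /(congr1 val); rewrite !vret.
  by move/val_inj/val_inj.
have fE : is_embedding [ffun z => f z].
  apply: (delete_leaf_split_emb (i := del_emb aL)) => // z.
  by rewrite ffunE.
exists (Embedding fE); apply: (eq_bij (f := f)) => [|z]; last by rewrite ffunE.
apply: inj_surj_bij => // y.
have ly : is_leaf (val (val y)) by rewrite -is_leaf_delete_leaf // (valP y).
have ya : exist _ (val (val y)) ly != aL by rewrite -val_eqE (valP (val y)).
exists (exist _ (exist _ (val (val y)) ly) ya); apply: val_inj => /=.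
exact: retractK.
Qed.

(** A neighbour of valence two becomes a leaf and replaces [a]. *)
Lemma delete_leaf_smooth_iso : valence x = 2%N ->
  exists f : embedding (leaf_struct T) (leaf_struct T'), is_iso f.
Proof.
move=> x2; have := valence_lt x; rewrite x2 => T2.
have T'1 : (1 < #|T'|)%N by have := card_delete_leaf adja; lia.
have lE (p : T') : is_leaf p = is_leaf (val p) || (val p == x).
  rewrite !is_leafE // (valence_delete_leaf p); case: (eqVneq (val p) x) => [e|_].
    by have := valence_delete_leaf p; rewrite e eqxx x2 addn1 => -[<-]; rewrite orbT.
  by rewrite addn0 orbF.
have xl : ~~ is_leaf x by rewrite is_leafE // x2.
have lf (z : leaf_struct T) : is_leaf (ret (val z) : T').
  rewrite lE val_retract; case: eqVneq => [e|] /=; first by rewrite eqxx orbT.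
  by rewrite (valP z).
pose f (z : leaf_struct T) : leaf_struct T' := exist _ (ret (val z)) (lf z).
have fi : injective f.
  move=> z w /(congr1 val) /= /(congr1 val); rewrite !val_retract.
  case: eqVneq => [e|zn]; case: eqVneq => [e'|wn] //= ee; apply: val_inj => //.
  - exact: etrans e (esym e').
  - by move: (valP w) xl; rewrite /= -ee => ->.
  - by move: (valP z) xl; rewrite /= ee => ->.
have idE : is_embedding (X := leaf_struct T) (Y := leaf_struct T) [ffun z => z].
  by apply/is_embeddingP; split=> [? ?|? ? ? ?]; rewrite !ffunE.
have fE : is_embedding [ffun z => f z].
  by apply: (delete_leaf_split_emb (i := Embedding idE)) => // z; rewrite ffunE.
exists (Embedding fE); apply: (eq_bij (f := f)) => [|z]; last by rewrite ffunE.
apply: inj_surj_bij => // y.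
have := valP y; rewrite /= lE => /orP[ly|/eqP yx].
  by exists (exist (fun z : T => is_leaf z) _ ly); apply: val_inj; exact: retractK.
exists aL; apply: val_inj => /=; apply: val_inj; rewrite val_retract eqxx /=.
exact: esym yx.
Qed.

End DeleteLeafStruct.

Section Geometry.
Variable T : tree.
Implicit Types (u v w x y z : T).

Lemma leaf_in_side y w : adj y w -> exists2 z, is_leaf z & z \in side w y.
Proof.
have T1 : adj y w -> (1 < #|T|)%N.
  move=> yw; apply: leq_ltn_trans (valence_lt w); apply/card_gt0P.
  by exists y; rewrite inE adj_sym.
have [n le] := ubnP #|side w y|; elim: n => // n IH in y w le T1 *.
move=> yw; have [lw|nw] := boolP (is_leaf w); first by exists w; rewrite ?side_refl.
have [w' ww' w'y] : exists2 w', adj w w' & w' != y.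
  move: nw; rewrite is_leafE ?T1 // => nw.
  have [w' ww'|no] := pickP [pred w' : T | adj w w' && (w' != y)].
    by exists w'; case/andP: ww'.
  case/eqP: nw; apply/eqP/cards1P; exists y; apply/setP=> z; rewrite !inE.
  have := no z; rewrite /=; case: eqVneq => [->|_]; first by rewrite adj_sym yw.
  by rewrite andbT.
have sub := side_nest yw ww' w'y.
have [z lz zw] : exists2 z, is_leaf z & z \in side w' w.
  apply: IH => [|_|//]; last exact: T1.
  by apply: leq_trans (proper_card sub) _; rewrite -ltnS.
by exists z => //; apply: (subsetP (proper_sub sub)).
Qed.

Lemma side_disjoint y w1 w2 : adj y w1 -> adj y w2 -> w1 != w2 ->
  [disjoint side w1 y & side w2 y].
Proof.
move=> yw1 yw2 ne; rewrite disjoint_sym disjoints_subset -sideC 1?adj_sym //.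
by apply/proper_sub/(side_nest _ yw2); rewrite 1?adj_sym // eq_sym.
Qed.

(** Only the edge at a leaf separates it from its neighbour. *)
Lemma leaf_separated x p u v : (1 < #|T|)%N -> is_leaf p -> adj x p -> adj u v ->
  (x \in side u v) != (p \in side u v) ->
  forall z, (z \in side u v) = (p \in side u v) -> z = p.
Proof.
move=> T1 lp xp uv ne z zp.
have px : adj p x by rewrite adj_sym.
have pS := side_leaf (valence1P T1 lp px).
have [pu|pu] := boolP (p \in side u v).
  rewrite pu in ne zp; have xu : x \notin side u v by case: (x \in _) ne.
  have [ep ex] := side_adj uv px pu xu.
  by move: zp; rewrite -ep -ex pS inE => /eqP.
rewrite (negPf pu) in ne zp; have xu : x \in side u v by case: (x \in _) ne.
have [ex ep] := side_adj uv xp xu pu.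
by move: zp; rewrite -ep -ex sideC // pS !inE => /negbFE/eqP.
Qed.

(** [y] is the neighbour of [x] that is allowed not to be a leaf. *)
Definition end_node x y : Prop :=
  [/\ @is_node T x, adj x y & forall w, adj x w -> w != y -> is_leaf w].

(** Walk from a node to a neighbouring node away from the previous vertex; the
    part of the tree still ahead shrinks at every step. *)
Lemma end_node_exists r : (1 < #|T|)%N -> @is_node T r -> exists x y, end_node x y.
Proof.
move=> T1 nr; have [u] : exists u, adj r u.
  by have /card_gt0P[u] := valence_gt0 r T1; rewrite inE; exists u.
have [n le] := ubnP #|side r u|; elim: n => // n IH in r u nr le * => ru.
have [w /and3P[rw wu nw]|no] := pickP [pred w : T | [&& adj r w, w != u & is_node w]].
  have ur : adj u r by rewrite adj_sym.
  apply: (IH w r nw) => //; last by rewrite adj_sym.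
  by apply: leq_trans (proper_card (side_nest ur rw wu)) _; rewrite -ltnS.
exists r, u; split=> // w rw wu; have := no w.
by rewrite /= rw wu /= /is_node => /negbFE.
Qed.

Lemma side_end_node x y z : end_node x y -> z \in side x y -> z = x \/ adj x z.
Proof.
move=> [nx xy lw]; have T1 : (1 < #|T|)%N.
  by apply: leq_ltn_trans (valence_lt x); apply/card_gt0P; exists y; rewrite inE.
rewrite inE => xz; suff: z = x \/ (adj x z /\ z != y) by case=> [|[]]; [left|right].
move: z xz; apply: connect_ind; first by left.
move=> p q [->|[xp py]] /andP[pq ne].
  right; split=> //; apply: contraNneq ne => ->.
  by rewrite !inE eqxx.
left; have px : adj p x by rewrite adj_sym.
by move: pq; rewrite (valence1P T1 (lw p xp py) px) => /eqP.
Qed.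

(** The leaves [p] and [r] hang at [x] and lie on different sides, so one of
    them is cut off from [x]; then it is alone on its side. *)
Lemma no_split_neighbours x p q r t : (1 < #|T|)%N ->
  is_leaf p -> is_leaf r -> adj x p -> adj x r -> q != p -> t != r ->
  ~ separates p q r t.
Proof.
move=> T1 lp lr xp xr qp tr [u [v [uv pu qu ru tu]]].
have [xu|xu] := boolP (x \in side u v).
  case/eqP: tr; apply: (leaf_separated T1 lr xr uv).
    by rewrite xu (negPf ru).
  by rewrite (negPf ru) (negPf tu).
case/eqP: qp; apply: (leaf_separated T1 lp xp uv).
  by rewrite pu (negPf xu).
by rewrite pu qu.
Qed.

Lemma neighbour_side x y b : adj x y -> adj x b -> b != y -> b \in side x y.
Proof.
move=> xy xb yb; rewrite -(side_step (p := x)) ?side_refl //.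
rewrite /cut /= xb !inE !xpair_eqE eqxx (negPf yb) /=.
by apply/negP => /andP[_ /eqP e]; rewrite e adj_irr in xb.
Qed.

Lemma split_end_node x y b b' c u : end_node x y -> adj x b -> adj x b' ->
  b != y -> b' != y -> c \notin side x y -> u \notin side x y ->
  separates b b' c u.
Proof.
by move=> [_ xy _] xb xb' yb yb' cS uS; exists x, y; split; rewrite // neighbour_side.
Qed.

(** Nothing branches off between [b] and [y]: an edge separating [b] from [c]
    and [d] is the edge at [b] or the edge from [x] to [y], neither of which leaves
    [u] with [b]; an edge beyond [y] cannot cut off both [c] and [d], which are in
    different branches. *)
Lemma no_split_cherry x y w1 w2 b c d u : end_node x y -> is_leaf b ->
  adj x b -> adj y w1 -> adj y w2 -> w1 != w2 ->
  c \in side w1 y -> d \in side w2 y -> u != b -> u != x -> ~~ adj x u ->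
  ~ separates b u c d.
Proof.
move=> en lb xb yw1 yw2 ne cw1 dw2 ub ux xu [p [q [pq bp up cp dp]]].
have [_ xy _] := en.
have T1 : (1 < #|T|)%N.
  by apply: leq_ltn_trans (valence_lt x); apply/card_gt0P; exists y; rewrite inE.
have [yp|yp] := boolP (y \in side p q).
  have := @side_connected T q p w1 y; rewrite sideC // !in_setC yp /= orbT.
  rewrite adj_sym yw1 => /(_ isT isT c d); rewrite !in_setC cp dp cw1.
  move=> /(_ isT isT) /esym dw1.
  by have /disjointFr/(_ dw1) := side_disjoint yw1 yw2 ne; rewrite dw2.
have [xp|xp] := boolP (x \in side p q); last first.
  case/eqP: ub; apply: (leaf_separated T1 lb xb pq); first by rewrite bp (negPf xp).
  by rewrite bp up.
have [ex ey] := side_adj pq xy xp yp.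
rewrite -ex -ey in up; case: (side_end_node en up) => [/eqP|]; first exact/negP.
exact/negP.
Qed.

End Geometry.

(** * Attaching a leaf is determined by the splits *)

Section Treelike.
Variables (Z : qstruct) (HZ : treelike Z).
Implicit Types a b c d e u v w : Z.
Local Notation S := (@qsplit Z).

Lemma qsplit_swapr a b c d : S a b c d = S a b d c.
Proof. by rewrite !(treelike_flip HZ a) (treelike_swap HZ). Qed.

Lemma qsplit_excl a b c d : S a b c d -> S a c b d = false.
Proof. by move/(treelike_excl HZ)/negPf. Qed.

Lemma qsplit_excl_swap a b c d : S a b c d -> S a d b c = false.
Proof. by rewrite qsplit_swapr; move/qsplit_excl. Qed.

Lemma qsplit_subst a b c d e : S a b c d -> e \notin [:: a; b; c; d] ->
  (S a e c d /\ S b e c d) \/ (S a b c e /\ S a b d e).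
Proof.
by move=> /(treelike_subst HZ) h /h /orP[] /andP[]; [left|right].
Qed.

Lemma qsplit_neq a b c d : S a b c d ->
  [/\ [/\ a != b, a != c & a != d], [/\ b != c & b != d] & c != d].
Proof.
move/(treelike_uniq HZ); rewrite /= !inE !negb_or.
by case/and4P=> /and3P[-> -> ->] /andP[-> ->] ->.
Qed.

Lemma qsplit_nuniq a b c d : ~~ uniq [:: a; b; c; d] -> S a b c d = false.
Proof. by apply: contraNF; apply: treelike_uniq. Qed.

(** If ab|uv, then [a] substituted into a split containing [b] lands next to
    [b], since next to [u] or [v] it would contradict ab|uv; and conversely. *)
Lemma qsplit_twin a b u v w : S a b u v -> w \notin [:: a; b; u; v] ->
  S a u v w = S b u v w.
Proof.
move=> abuv; have [[ab au av] [bu bv] uv] := qsplit_neq abuv.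
rewrite !inE !negb_or => /and4P[wa wb wu wv].
have H p q : S p q u v -> p != q -> p != u -> p != v -> w != p -> q != u ->
    q != v -> w != q -> S p u v w -> S q u v w.
  move=> pquv pq pu pv wp qu qv wq h.
  have [|[_]|[h2 _]] := qsplit_subst (e := q) h.
  - by rewrite !inE !negb_or qu qv eq_sym pq eq_sym wq.
  - by rewrite (treelike_swap HZ).
  - by move: h2; rewrite qsplit_swapr (qsplit_excl pquv).
apply/idP/idP; apply: H; rewrite // 1?eq_sym //.
by rewrite (treelike_swap HZ).
Qed.

End Treelike.

(** Here [W] is T \ a and [Z] is any amalgamation.  As no point of [W] splits off
    with [b] from [c] and [d], the new point [a] does so alone, and then forms a cherry
    with [b] relative to every pair of points. *)
Lemma cherry_attachment (W Z : qstruct) (e : embedding W Z) (b c d : W) (a : Z) :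
  treelike Z ->
  qsplit a (e b) (e c) (e d) -> (forall u, ~~ qsplit b u c d) ->
  (forall w, e w != a) /\
  (forall u v w, qsplit a (e u) (e v) (e w) =
     (u == b) && uniq [:: u; v; w] || qsplit b u v w).
Proof.
move=> HZ abcd nb; have HW := treelike_emb e HZ.
have ea w : e w != a.
  apply: contraTneq abcd => <-; rewrite emb_split (treelike_swap HW); exact: nb.
have ee u v : (e u == e v) = (u == v) by apply: inj_eq; apply: emb_inj.
have [_ [bc bd] cd] := qsplit_neq HZ abcd; rewrite !ee in bc bd cd.
(* Substituting v in ab|cd: it cannot join b, so ab|cv. *)
have A1 v : v \notin [:: b; c; d] -> qsplit a (e b) (e c) (e v).
  rewrite !inE !negb_or => /and3P[vb vc vd].
  have [|[_]|[]//] := qsplit_subst HZ (e := e v) abcd.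
    by rewrite !inE !negb_or ea !ee vb vc.
  by rewrite emb_split (negPf (nb v)).
have Ac v : v != b -> v != c -> qsplit a (e b) (e c) (e v).
  move=> vb vc; have [->//|vd] := eqVneq v d.
  by apply: A1; rewrite !inE !negb_or vb vc.
(* If ab|uv failed, substitution would give both bu|cv and bv|cu. *)
have A2 u v : u != b -> v != b -> u != v -> qsplit a (e b) (e u) (e v).
  move=> ub vb uv; have vu : v != u by rewrite eq_sym.
  have [eu|uc] := eqVneq u c; first by rewrite eu Ac // -eu.
  have [ev|vc] := eqVneq v c; first by rewrite ev (qsplit_swapr HZ) Ac // -ev.
  have H p q : p != b -> q != b -> p != q -> p != c -> q != c ->
      qsplit a (e b) (e p) (e q) \/ qsplit (e b) (e p) (e c) (e q).
    move=> pb qb pq pc qc.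
    have [|[_]|[_ h]] := qsplit_subst HZ (e := e p) (Ac _ qb qc).
    - by rewrite !inE !negb_or ea !ee pb pc pq.
    - by right.
    - by left; rewrite (qsplit_swapr HZ).
  have [//|h1] := H u v ub vb uv uc vc.
  have [h|h2] := H v u vb ub vu vc uc; first by rewrite (qsplit_swapr HZ).
  by rewrite (qsplit_swapr HZ) (qsplit_excl_swap HZ h1) in h2.
split=> [//|u v w].
have [un|un] := boolP (uniq [:: u; v; w]); last first.
  rewrite andbF /=; have un' : ~~ uniq [:: e u; e v; e w].
    by rewrite -[[:: e u; _; _]]/(map e [:: u; v; w]) (map_inj_uniq (@emb_inj _ _ e)).
  rewrite (qsplit_nuniq HZ) ?(qsplit_nuniq HW) //.
    by rewrite cons_uniq negb_and un orbT.
  by rewrite cons_uniq negb_and un' orbT.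
have := un; rewrite andbT /= !inE !negb_or => /and3P[/andP[uv uw] vw _].
have vu : v != u by rewrite eq_sym.
have wu : w != u by rewrite eq_sym.
have [eu|ub] /= := eqVneq u b; first by subst u; apply: A2.
have [ev|vb] := eqVneq v b.
  subst v; rewrite [RHS](qsplit_nuniq HW); last by rewrite /= !inE eqxx /= orbT.
  have [->|wb] := eqVneq w b; first by rewrite (qsplit_nuniq HZ) //= !inE eqxx !andbF.
  exact: (qsplit_excl HZ (A2 u w ub wb uw)).
have [ew|wb] := eqVneq w b.
  subst w; rewrite [RHS](qsplit_nuniq HW); last by rewrite /= !inE eqxx /= !orbT.
  by rewrite (qsplit_swapr HZ) (qsplit_excl HZ (A2 u v ub vb uv)).
rewrite (qsplit_twin HZ (A2 u v ub vb uv)) ?emb_split //.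
by rewrite !inE !negb_or ea !ee wb wu eq_sym vw.
Qed.

(** Here [W] is T \ a, [B] consists of the leaves other than [a] at the end node
    x, and [c] lies beyond the remaining neighbour of x.  By the last hypothesis [a]
    joins the star formed by [c] and [B]; substituting [a] into the splits bb'|cu of
    [W] then leaves it no choice but to behave like one more element of [B]. *)
Lemma star_attachment (W Z : qstruct) (e : embedding W Z) (B : {set W}) (c b0 b1 : W)
    (a : Z) :
  treelike Z -> c \notin B -> b0 \in B -> b1 \in B -> b0 != b1 ->
  (forall b b' u, b \in B -> b' \in B -> b != b' -> u \notin B -> u != c ->
     qsplit b b' c u) ->
  (forall p, p \in c |: B -> e p != a) ->
  (forall p q r, p \in c |: B -> q \in c |: B -> r \in c |: B ->
     ~~ qsplit a (e p) (e q) (e r)) ->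
  (forall w, e w != a) /\
  (forall u v w, qsplit a (e u) (e v) (e w) = [exists b in B, qsplit b u v w]).
Proof.
move=> HZ cB b0B b1B b01 H1 H3 H2; have HW := treelike_emb e HZ.
have other b : b \in B -> exists2 b', b' \in B & b != b'.
  by have [->|ne] := eqVneq b b0; [exists b1 | exists b0].
have BS b : b \in B -> b \in c |: B by move=> bB; rewrite !inE bB orbT.
have cS : c \in c |: B by rewrite !inE eqxx.
have ne b u : b \in B -> u \notin B -> b != u.
  by move=> bB; apply: contraNneq => <-.
have swr := qsplit_swapr HZ; have swl := treelike_swap HZ.
have flip := treelike_flip HZ.
have ea w : e w != a.
  have [wS|] := boolP (w \in c |: B); first exact: H3.
  rewrite !inE negb_or => /andP[wc wB].
  have := H1 _ _ _ b0B b1B b01 wB wc; rewrite -(emb_split e).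
  by apply: contraTneq => ->; rewrite flip swl H2 // BS.
have ee u v : (e u == e v) = (u == v) by apply: inj_eq; apply: emb_inj.
have nS p q r : p \in c |: B -> q \in c |: B -> r \in c |: B ->
    qsplit a (e p) (e q) (e r) = false.
  by move=> *; apply/negbTE/H2.
have nB b b' : b \in B -> b' \in B -> qsplit a (e c) (e b) (e b') = false.
  by move=> bB b'B; rewrite nS ?cS //; apply: BS.
(* Substituting a in bb'|cu: joining c and u would contradict the star. *)
have G1 b u : b \in B -> u \notin B -> u != c -> qsplit a (e b) (e c) (e u).
  move=> bB uB uc; have [b' b'B bb'] := other b bB.
  have := H1 _ _ _ bB b'B bb' uB uc; rewrite -(emb_split e) => h.
  have [|[h1 _]|[h1 _]] := qsplit_subst HZ (e := a) h.
  - by rewrite !inE !negb_or ![a == _]eq_sym !ea.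
  - by rewrite swl.
  - by rewrite swr flip nB in h1.
have G2' u v b b' : u \notin B -> v \notin B -> u != v -> b \in B -> b' \in B ->
    b != b' -> qsplit (e b) (e b') (e u) (e v).
  move=> uB vB uv bB b'B bb'.
  have [eu|uc] := eqVneq u c; first by rewrite eu emb_split H1 // eq_sym -eu.
  have [->|vc] := eqVneq v c; first by rewrite swr emb_split H1.
  have hu := H1 _ _ _ bB b'B bb' uB uc; have hv := H1 _ _ _ bB b'B bb' vB vc.
  rewrite emb_split.
  have [|[h _]|[_ h]] := qsplit_subst HW (e := v) hu.
  - by rewrite !inE !negb_or vc eq_sym ne // eq_sym ne // eq_sym uv.
  - have [|[h' _]|[_ h']] := qsplit_subst HW (e := u) hv.
    + by rewrite !inE !negb_or uc eq_sym ne // eq_sym ne // uv.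
    + by rewrite (qsplit_swapr HW) (qsplit_excl_swap HW h) in h'.
    + by rewrite (qsplit_swapr HW).
  - exact: h.
have G2 u v b : u \notin B -> v \notin B -> u != v -> b \in B ->
    qsplit a (e b) (e u) (e v).
  move=> uB vB uv bB; have [eu|uc] := eqVneq u c.
    by rewrite eu G1 // eq_sym -eu.
  have [ev|vc] := eqVneq v c; first by rewrite ev swr G1.
  have [b' b'B bb'] := other b bB.
  have [|[h1 _]|[h1 _]] := qsplit_subst HZ (e := a) (G2' u v b b' uB vB uv bB b'B bb').
  - by rewrite !inE !negb_or ![a == _]eq_sym !ea.
  - by rewrite swl.
  have [|[h2 _]|[_ h2]] := qsplit_subst HZ (e := e c) h1.
  - rewrite !inE !negb_or !ee ea [c == u]eq_sym uc andbT.
    by rewrite ![c == _]eq_sym !(ne _ _ _ cB).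
  - by rewrite swr flip (qsplit_excl_swap HZ (G1 b u bB uB uc)) in h2.
  - by rewrite flip nB in h2.
(* A split of a involves at most one element of B; L1, L2 and L3 rule out the
   corresponding splits of an element of B. *)
have K1 p q w : p \in B -> q \in B -> qsplit a (e p) (e q) (e w) = false.
  move=> pB qB; have [wS|] := boolP (w \in c |: B); first by apply: nS => //; exact: BS.
  rewrite !inE negb_or => /andP[wc wB]; apply/negP => h.
  have [|[h2 _]|[h2 _]] := qsplit_subst HZ (e := e c) h.
  - by rewrite !inE !negb_or !ee ea ![c == _]eq_sym wc !(ne _ _ _ cB).
  - by rewrite (qsplit_excl HZ (G1 q w qB wB wc)) in h2.
  - by rewrite nS ?cS // in h2; apply: BS.
have K2 u v w : v \in B -> w \in B -> qsplit a (e u) (e v) (e w) = false.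
  move=> vB wB; have [uB|uB] := boolP (u \in B); first exact: K1.
  have [->|uc] := eqVneq u c; first exact: nB.
  apply/negP => h; have [_ [uv uw] vw] := qsplit_neq HZ h.
  have [|[h2 _]|[h2 _]] := qsplit_subst HZ (e := e c) h.
  - by rewrite !inE !negb_or !ee ea ![c == _]eq_sym uc !(ne _ _ _ cB).
  - by rewrite nB in h2.
  - by rewrite (qsplit_excl_swap HZ (G1 v u vB uB uc)) in h2.
have L1 b u v w : b \in B -> u \in B -> v \in B -> qsplit b u v w = false.
  move=> bB uB vB; apply/negP; rewrite -(emb_split e) => h.
  have [|[h2 _]|[h2 _]] := qsplit_subst HZ (e := a) h.
  - by rewrite !inE !negb_or ![a == _]eq_sym !ea.
  - by rewrite swl K1 in h2.
  - by rewrite flip swl K1 in h2.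
have L2 b u v w : b \in B -> v \in B -> w \in B -> qsplit b u v w = false.
  move=> bB vB wB; have [uB|uB] := boolP (u \in B); first exact: L1.
  apply/negP; rewrite -(emb_split e) => h.
  have [|[h2 _]|[h2 _]] := qsplit_subst HZ (e := a) h.
  - by rewrite !inE !negb_or ![a == _]eq_sym !ea.
  - by rewrite swl K2 in h2.
  - by rewrite flip swl K1 in h2.
have L3 b u v w : b \in B -> v \in B -> u \notin B -> w \notin B ->
    qsplit b u v w = false.
  move=> bB vB uB wB; have [eb|bv] := eqVneq b v.
    by subst v; rewrite (qsplit_nuniq HW) //= !inE eqxx /= orbT.
  have [euw|uw] := eqVneq u w.
    by subst w; rewrite (qsplit_nuniq HW) //= !inE eqxx /= !orbT andbF.
  by have := G2' u w b v uB wB uw bB vB bv; rewrite emb_split => /(qsplit_excl HW).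
split=> [//|u v w].
have [un|un] := boolP (uniq [:: u; v; w]); last first.
  have -> : [exists b in B, qsplit b u v w] = false.
    apply/existsP => -[b /andP[_]]; apply/negP/negbT/(qsplit_nuniq HW).
    by rewrite cons_uniq negb_and un orbT.
  apply: (qsplit_nuniq HZ); rewrite cons_uniq negb_and.
  by rewrite -[[:: e u; _; _]]/(map e [:: u; v; w]) (map_inj_uniq (@emb_inj _ _ e)) un orbT.
have := un; rewrite /= !inE !negb_or => /and3P[/andP[uv uw] vw _].
have exF (P : pred W) : (forall b, b \in B -> P b = false) -> [exists b in B, P b] = false.
  by move=> H; apply/existsP => -[b /andP[/H->]].
have [vB|vB] := boolP (v \in B); have [wB|wB] := boolP (w \in B).
- by rewrite K2 // exF // => b bB; apply: L2.
- have [uB|uB] := boolP (u \in B); first by rewrite K1 // exF // => b bB; apply: L1.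
  by rewrite exF => [|b bB]; [rewrite (qsplit_excl HZ (G2 u w v uB wB uw vB)) | exact: L3].
- have [uB|uB] := boolP (u \in B).
    by rewrite swr K1 // exF // => b bB; rewrite (qsplit_swapr HW); apply: L1.
  rewrite swr exF => [|b bB]; first by rewrite (qsplit_excl HZ (G2 u v w uB vB uv wB)).
  by rewrite (qsplit_swapr HW); exact: L3.
have [uB|uB] := boolP (u \in B).
  rewrite G2 //; symmetry; have [b bB ub] := other u uB.
  by apply/existsP; exists b; rewrite bB -(emb_split e) G2' // eq_sym.
have tw b : b \in B -> qsplit a (e u) (e v) (e w) = qsplit b u v w.
  move=> bB; rewrite -(emb_split e); apply: (qsplit_twin HZ); first exact: G2.
  by rewrite !inE !negb_or ea !ee eq_sym ne // eq_sym uw eq_sym vw.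
apply/idP/existsP => [h|[b /andP[bB h]]]; last by rewrite (tw b).
by exists b0; rewrite b0B -(tw b0).
Qed.

(** * Transfer of marked values *)

Lemma emb_inverse (X Y : qstruct) (g : embedding X Y) : is_iso g ->
  exists h : embedding Y X, cancel g h /\ cancel h g.
Proof.
case=> h gh hg; have hE : is_embedding [ffun y => h y].
  apply/is_embeddingP; split=> [y y'|x1 x2 y1 y2]; rewrite !ffunE.
    exact: (can_inj hg).
  by rewrite -(emb_rel g) !hg.
by exists (Embedding hE); split=> x; rewrite ffunE.
Qed.

Section Measure.
Variables (R : comPzRingType) (mu : forall X Y : qstruct, embedding X Y -> R).
Hypothesis mu_measure : is_measure mu.

Lemma tree_structure_leaf (T : tree) : tree_structure (leaf_struct T).
Proof.
right; exists T.
have idE : is_embedding (X := leaf_struct T) (Y := leaf_struct T) [ffun z => z].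
  by apply/is_embeddingP; split=> [? ?|? ? ? ?]; rewrite !ffunE.
by exists (Embedding idE); exists id => z; rewrite ffunE.
Qed.

Lemma tree_structure_empty : tree_structure qempty.
Proof. by left; rewrite card_void. Qed.

Lemma measure_from_empty_iso (X Y : qstruct) (f : embedding X Y) :
  tree_structure X -> tree_structure Y -> is_iso f ->
  mu (from_empty X) = mu (from_empty Y).
Proof.
move=> hX hY fi; have -> : from_empty Y = emb_comp f (from_empty X).
  by apply: emb_eq; case.
rewrite (measure_comp mu_measure) //; last exact: tree_structure_empty.
by rewrite (measure_iso mu_measure hX hY fi) mul1r.
Qed.

Lemma mu_tree_delete (T : tree) (a : leaf_struct T) : tree_structure (qdel a) ->
  mu_tree mu T = mu_marked mu a * mu (from_empty (qdel a)).
Proof.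
move=> ha; rewrite /mu_tree.
have -> : from_empty (leaf_struct T) = emb_comp (del_emb a) (from_empty (qdel a)).
  by apply: emb_eq; case.
by rewrite (measure_comp mu_measure) //; [exact: tree_structure_empty | exact: tree_structure_leaf].
Qed.

Lemma del_cases (X : qstruct) (a p : X) : p = a \/ exists w : qdel a, p = del_emb a w.
Proof.
have [->|pa] := eqVneq p a; [by left | right].
by exists (exist _ p pa); rewrite ffunE.
Qed.

Lemma del_emb_neq (X : qstruct) (a : X) (w : qdel a) : del_emb a w != a.
Proof. by rewrite ffunE; apply: (valP w). Qed.

Lemma is_embedding_restrict (X Y : qstruct) (f : embedding X Y) (s : X) (a : Y)
    (f' : qdel s -> qdel a) :
  (forall y, del_emb a (f' y) = f (del_emb s y)) -> is_embedding [ffun y => f' y].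
Proof.
move=> fE; apply/is_embeddingP; split=> [y z|x1 x2 y1 y2]; rewrite !ffunE.
  by move/(congr1 (del_emb a)); rewrite !fE => /emb_inj/emb_inj.
by rewrite -(emb_rel (del_emb a)) !fE !emb_rel.
Qed.

(** Suppose that in every common extension of [S] and T \ a the marked leaf is
    new and its splits are given by one formula [F].  Then every amalgamation is
    isomorphic to [T], and the amalgamation axiom equates the two marked values.  The
    hypothesis also applies to [T] itself, which shows that [F] describes [T]. *)
Lemma mu_marked_transfer (S T : tree) (s : leaf_struct S) (a : leaf_struct T)
    (f : embedding (leaf_struct S) (leaf_struct T))
    (F : qdel a -> qdel a -> qdel a -> bool) :
  f s = a -> tree_structure (qdel s) -> tree_structure (qdel a) ->
  (forall Z (e1 : embedding (leaf_struct S) Z) (e2 : embedding (qdel a) Z),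
     treelike Z -> (forall y w, f y = del_emb a w -> e1 y = e2 w) ->
     (forall w, e2 w != e1 s) /\
     (forall u v w, qsplit (e1 s) (e2 u) (e2 v) (e2 w) = F u v w)) ->
  mu_marked mu s = mu_marked mu a.
Proof.
move=> fs hs ha H.
have f'P (y : qdel s) : f (val y) != a.
  by rewrite -fs (inj_eq (@emb_inj _ _ f)); apply: (valP y).
pose f' (y : qdel s) : qdel a := exist _ (f (val y)) (f'P y).
have f'E y : del_emb a (f' y) = f (del_emb s y) by rewrite !ffunE.
have f'emb := is_embedding_restrict f'E.
pose j := Embedding f'emb.
have HT := treelike_leaf_struct T.
have [_ FT] : (forall w, del_emb a w != f s) /\ forall u v w,
    qsplit (f s) (del_emb a u) (del_emb a v) (del_emb a w) = F u v w.
  by apply: H.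
have comm0 : emb_comp f (del_emb s) = emb_comp (del_emb a) j.
  by apply: emb_eq => y; rewrite !emb_compE -f'E [j y]ffunE.
have surj0 (z : leaf_struct T) : (exists y, f y = z) \/ (exists y, del_emb a y = z).
  by case: (del_cases a z) => [->|[w ->]]; [left; exists s | right; exists w].
(* T itself is an amalgamation; the rest shows that it is the only one. *)
pose A0 : amalgamation (del_emb s) j :=
  Amalgamation (tree_structure_leaf T) comm0 surj0.
rewrite /mu_marked (measure_amalg mu_measure (I := unit) (A := fun=> A0)) //.
- by rewrite (big_pred1 tt) //; case.
- exact: tree_structure_leaf.
move=> [Z hZ e1 e2 comm surj]; exists tt; split; last by case.
have HZ := treelike_tree_structure hZ.
have agree y w : f y = del_emb a w -> e1 y = e2 w.
  case: (del_cases s y) => [->|[y' ->]] fw.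
    by have := del_emb_neq w; rewrite -fw fs eqxx.
  have := congr1 (fun e : embedding _ _ => e y') comm; rewrite !emb_compE => ->.
  congr (e2 _); apply: (@emb_inj _ _ (del_emb a)).
  by rewrite -fw -f'E [j _]ffunE.
have [es FZ] := H Z e1 e2 HZ agree.
(* The comparison map from T to an arbitrary amalgamation Z. *)
pose g (p : leaf_struct T) : Z :=
  if insub p is Some w then e2 (w : qdel a) else e1 s.
have ga : g a = e1 s by rewrite /g insubF ?eqxx.
have gw w : g (del_emb a w) = e2 w by rewrite /g ffunE valK.
have gi : injective g.
  move=> p q; case: (del_cases a p) (del_cases a q) => [->|[w ->]] [->|[w' ->]] //;
    rewrite ?ga ?gw.
  - by move/esym/eqP; rewrite (negPf (es _)).
  - by move/eqP; rewrite (negPf (es _)).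
  - by move/emb_inj ->.
have gs p q r t : uniq [:: p; q; r; t] ->
    qsplit (g p) (g q) (g r) (g t) = qsplit p q r t.
  rewrite /= !inE !negb_or => /and4P[/and3P[pq pr pt] /andP[qr qt] rt _].
  rewrite fs in FT.
  have Fa u v w : u != a -> v != a -> w != a ->
      qsplit (g a) (g u) (g v) (g w) = qsplit a u v w.
    case: (del_cases a u) => [->|[u' ->]]; first by rewrite eqxx.
    case: (del_cases a v) => [->|[v' ->]]; first by rewrite eqxx.
    case: (del_cases a w) => [->|[w' ->]]; first by rewrite eqxx.
    by rewrite ga !gw FZ FT.
  have [e|pa] := eqVneq p a; first by subst p; rewrite Fa // eq_sym.
  have [e|qa] := eqVneq q a.
    by subst q; rewrite (treelike_swap HZ) (treelike_swap HT) Fa // eq_sym.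
  have [e|ra] := eqVneq r a.
    by subst r; rewrite (treelike_flip HZ) (treelike_flip HT) Fa // eq_sym.
  have [e|ta] := eqVneq t a.
    subst t; rewrite (treelike_flip HZ) (treelike_flip HT).
    by rewrite (treelike_swap HZ) (treelike_swap HT) Fa.
  case: (del_cases a p) pa => [->|[p' ->]]; first by rewrite eqxx.
  case: (del_cases a q) qa => [->|[q' ->]]; first by rewrite eqxx.
  case: (del_cases a r) ra => [->|[r' ->]]; first by rewrite eqxx.
  case: (del_cases a t) ta => [->|[t' ->]]; first by rewrite eqxx.
  by rewrite !gw !emb_split.
have gE := is_embedding_split HT HZ gi gs.
have giso : is_iso (Embedding gE).
  apply: (eq_bij (f := g)) => [|z]; last by rewrite ffunE.
  apply: inj_surj_bij => // z; case: (surj z) => -[y <-].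
    case: (del_cases a (f y)) => [e|[w e]]; last first.
      by exists (f y); rewrite e gw (agree _ _ e).
    by exists a; rewrite ga -(emb_inj (etrans fs (esym e))).
  by exists (del_emb a y); rewrite gw.
have [h [gh hg]] := emb_inverse giso.
have gE' p : Embedding gE p = g p by rewrite ffunE.
exists h; split; first by exists (Embedding gE).
  apply: emb_eq => y; rewrite emb_compE /=; apply: (can_inj gh); rewrite hg gE'.
  case: (del_cases a (f y)) => [e|[w e]]; last by rewrite e gw (agree _ _ e).
  by rewrite e ga -(emb_inj (etrans fs (esym e))).
by apply: emb_eq => y; rewrite emb_compE /=; apply: (can_inj gh); rewrite hg gE' gw.
Qed.

End Measure.

(** * Two model trees *)

(** A parent function decreasing a height presents a tree: a vertex of maximal
    height on a cycle could only have its parent as a neighbour there. *)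
Section RootedTree.
Variables (V : finType) (par : V -> V) (h : V -> nat) (r : V).
Hypothesis par_root : par r = r.
Hypothesis height_par : forall p, p != r -> (h (par p) < h p)%N.

Definition parent_rel : rel V := [rel p q | (p != q) && ((par p == q) || (par q == p))].

Lemma parent_rel_sym : symmetric parent_rel.
Proof. by move=> p q; rewrite /parent_rel /= eq_sym orbC. Qed.

Lemma parent_rel_irr : irreflexive parent_rel.
Proof. by move=> p; rewrite /parent_rel /= eqxx. Qed.

Lemma rooted_tree_nonempty : (0 < #|V|)%N.
Proof. by apply/card_gt0P; exists r. Qed.

Lemma rooted_tree_connected p q : connect parent_rel p q.
Proof.
suff H p' : connect parent_rel p' r.
  by apply: connect_trans (H p) _; rewrite (sym_connect_sym parent_rel_sym).
have [n] := ubnP (h p'); elim: n p' => // n IH s le.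
have [->|sr] := eqVneq s r; first exact: connect0.
have lt := height_par sr.
apply: (@connect_trans _ _ (par s)); last by apply: IH; lia.
apply: connect1; rewrite /parent_rel /= eqxx andbT.
by apply: contraTneq lt => <-; rewrite ltnn.
Qed.

Lemma parent_rel_higher p q : parent_rel p q -> (h q <= h p)%N -> par p = q.
Proof.
move=> /andP[pq /orP[/eqP//|/eqP e]] le.
have [er|qr] := eqVneq q r; first by move: pq; rewrite -e er par_root eqxx.
by have := height_par qr; rewrite e ltnNge le.
Qed.

Lemma rooted_tree_acyclic c : ucycle parent_rel c -> (size c <= 2)%N.
Proof.
case: c => // p0 c /andP[cc uc]; have p0c : p0 \in p0 :: c by rewrite inE eqxx.
case: (arg_maxnP (P := [in p0 :: c]) h p0c) => p pc max.
case: (rot_to pc) => i s es; rewrite -(size_rot i) es.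
move: cc uc; rewrite -(rot_cycle i) -(rot_uniq i) es => cc us.
have maxs q : q \in s -> (h q <= h p)%N.
  by move=> qs; apply: max; rewrite -(mem_rot i) es inE qs orbT.
case: s {es} cc us maxs => // q; case/lastP=> // s l.
rewrite /= rcons_path last_rcons => /and3P[pq _ lp] us maxs.
have eq := parent_rel_higher pq (maxs q (mem_head _ _)).
rewrite parent_rel_sym in lp.
have el : par p = l.
  by apply: parent_rel_higher lp (maxs l _); rewrite inE mem_rcons mem_head orbT.
by move: us; rewrite -eq el mem_rcons mem_head /= !andbF.
Qed.

Definition rooted_tree : tree :=
  Tree parent_rel_sym parent_rel_irr rooted_tree_nonempty rooted_tree_connected
    rooted_tree_acyclic.

End RootedTree.

Section Star.
Variable D : finType.

Let star_height (p : option D) : nat := p != None.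

Let star_height_par (p : option D) : p != None ->
  (star_height None < star_height p)%N.
Proof. by rewrite /star_height => ->; rewrite eqxx. Qed.

Definition star : tree :=
  @rooted_tree (option D) (fun=> None) star_height None erefl star_height_par.

Lemma star_adj_center (p : star) : adj (None : star) p = (p != None).
Proof. by rewrite /= /parent_rel /= orbT andbT eq_sym. Qed.

Lemma star_adj_leaf d (p : star) : adj (Some d : star) p = (p == None).
Proof. by case: p => //= d'; rewrite /parent_rel /= andbF. Qed.

Lemma star_valence_center : valence (None : star) = #|D|.
Proof.
have Some_inj : injective (@Some D) by move=> ? ? [].
rewrite /valence -(card_imset _ Some_inj); apply: eq_card => -[d|].
  by rewrite inE star_adj_center imset_f.
by rewrite inE star_adj_center; apply/esym/negP => /imsetP[].
Qed.

Lemma star_leaf d : is_leaf (Some d : star).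
Proof.
apply/orP; left; apply/cards1P; exists None; apply/setP=> p.
by rewrite !inE star_adj_leaf.
Qed.

Hypothesis D3 : (2 < #|D|)%N.

Lemma star_center_node : is_node (None : star).
Proof.
have V1 : (1 < #|star|)%N by rewrite card_option; lia.
by rewrite /is_node is_leafE // star_valence_center; lia.
Qed.

Lemma star_end_node d : end_node (None : star) (Some d).
Proof.
split; [exact: star_center_node | by rewrite star_adj_center |].
by case=> [d' _ _|]; [exact: star_leaf | rewrite adj_irr].
Qed.

Lemma star_leafP (p : leaf_struct star) : exists d, p = exist _ (Some d) (star_leaf d).
Proof.
case: p => [[d|] pl]; first by exists d; apply: val_inj.
by case/negP: star_center_node.
Qed.

Lemma star_rel (p q s t : leaf_struct star) : qrel p q s t = false.
Proof.
have V1 : (1 < #|star|)%N by rewrite card_option; lia.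
have sp (p1 q1 s1 t1 : leaf_struct star) : qsplit p1 q1 s1 t1 = false.
  apply/negP => /qsplitP[un]; move: un.
  case: (star_leafP p1) (star_leafP s1) => d -> [d' ->].
  rewrite /= !inE !negb_or => /and4P[/and3P[pq _ _] _ st _].
  apply: (no_split_neighbours (x := None : star) V1 (star_leaf d) (star_leaf d'));
    rewrite ?star_adj_center // eq_sym; [exact: pq | exact: st].
by rewrite (treelike_rel (treelike_leaf_struct star)) !sp.
Qed.

End Star.

Lemma end_node_is_star (T : tree) (x y : T) : end_node x y -> is_leaf y ->
  is_star (valence x) T.
Proof.
move=> en ly; have [nx xy lx] := en.
have T1 : (1 < #|T|)%N.
  by apply: leq_ltn_trans (valence_lt x); apply/card_gt0P; exists y; rewrite inE.
have nbr w : adj x w -> is_leaf w by have [->|/lx h /h] := eqVneq w y.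
exists x; split.
  move=> z; split=> [nz|->//].
  have [zS|] := boolP (z \in side x y).
    by case: (side_end_node en zS) => // /nbr lz; rewrite /is_node lz in nz.
  have yx : adj y x by rewrite adj_sym.
  rewrite -in_setC -sideC // (side_leaf (valence1P T1 ly yx)) inE => /eqP e.
  by rewrite e /is_node ly in nz.
apply: eq_card => w; rewrite !inE; case xw: (adj x w) => //=; exact: nbr.
Qed.

Section DoubleStar.

Local Notation V := (option bool * bool)%type.

Let ds_par (p : V) : V := (None, (p.1 != None) && p.2).
Let ds_height (p : V) : nat := (p.1 != None).*2 + p.2.

Let ds_par_root : ds_par (None, false) = (None, false). Proof. by []. Qed.
Let ds_height_par p : p != (None, false) -> (ds_height (ds_par p) < ds_height p)%N.
Proof. by case: p => -[[]|] []. Qed.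

(** The tree Y: the centre on side [i] is [(None, i)], and [(Some j, i)] are the
    two leaves attached to it. *)
Definition double_star : tree :=
  @rooted_tree V ds_par ds_height (None, false) ds_par_root ds_height_par.

Definition ds_center (i : bool) : double_star := (None, i).
Definition ds_end (j i : bool) : double_star := (Some j, i).

Lemma ds_adj_center i (p : double_star) :
  adj (ds_center i) p = (p \in [set ds_center (~~ i); ds_end false i; ds_end true i]).
Proof. by rewrite !inE; case: p i => -[[]|] [] []. Qed.

Lemma ds_adj_end j i (p : double_star) : adj (ds_end j i) p = (p == ds_center i).
Proof. by case: p i j => -[[]|] [] [] []. Qed.

Lemma ds_valence_center i : valence (ds_center i) = 3%N.
Proof.
transitivity #|[set ds_center (~~ i); ds_end false i; ds_end true i]|.
  by apply: eq_card => p; rewrite inE ds_adj_center.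
by rewrite -setUA !cardsU1 cards1 !inE; case: i.
Qed.

Lemma ds_card : (1 < #|double_star|)%N.
Proof. by rewrite card_prod card_option card_bool. Qed.

Lemma ds_end_leaf j i : is_leaf (ds_end j i).
Proof.
rewrite is_leafE ?ds_card //; apply/cards1P; exists (ds_center i); apply/setP=> p.
by rewrite !inE ds_adj_end.
Qed.

Lemma ds_center_node i : is_node (ds_center i).
Proof. by rewrite /is_node is_leafE ?ds_card // ds_valence_center. Qed.

Lemma ds_end_node i : end_node (ds_center i) (ds_center (~~ i)).
Proof.
split; [exact: ds_center_node | by rewrite ds_adj_center !inE eqxx |].
move=> w; rewrite ds_adj_center !inE -orbA => /or3P[] /eqP -> //; rewrite ?eqxx //.
  by move=> _; exact: ds_end_leaf.
by move=> _; exact: ds_end_leaf.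
Qed.

Lemma double_star_is_Y : is_Y double_star.
Proof.
exists (ds_center false), (ds_center true); split.
- by rewrite ds_adj_center !inE eqxx.
- move=> [[j|] i]; split.
  + by move=> n; have := ds_end_leaf j i; move: n; rewrite /is_node => /negP.
  + by case.
  + by case: i; [right | left].
  + by move=> _; exact: (ds_center_node i).
- transitivity #|[set ds_end false false; ds_end true false]|; last by rewrite cards2.
  apply: eq_card => p; rewrite !inE ds_adj_center !inE.
  case: p => [[[]|] []] //=; by [exact: ds_end_leaf | exact: negbTE (ds_center_node _)].
- transitivity #|[set ds_end false true; ds_end true true]|; last by rewrite cards2.
  apply: eq_card => p; rewrite !inE ds_adj_center !inE.
  case: p => [[[]|] []] //=; by [exact: ds_end_leaf | exact: negbTE (ds_center_node _)].
Qed.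

Definition ds_leaf (j i : bool) : leaf_struct double_star :=
  exist _ (ds_end j i) (ds_end_leaf j i).

Lemma ds_leafP (p : leaf_struct double_star) : exists j i, p = ds_leaf j i.
Proof.
case: p => [[[j|] i] pl]; first by exists j, i; apply: val_inj.
by case/negP: (ds_center_node i).
Qed.

Lemma ds_split : qsplit (ds_leaf false false) (ds_leaf true false)
  (ds_leaf false true) (ds_leaf true true).
Proof.
apply/qsplitP; split=> //; apply: (split_end_node (ds_end_node false)) => //=.
- apply/negP => /(side_end_node (ds_end_node false))[]//.
- apply/negP => /(side_end_node (ds_end_node false))[]//.
Qed.

End DoubleStar.

(** * Marked values at an end node *)

Lemma tree_structure_del (T : tree) (a : leaf_struct T) (x : T) :
  (forall z, adj (val a) z = (z == x)) -> valence x != 2%N ->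
  tree_structure (qdel a).
Proof.
case: a => a la /= adja x2; right.
have [f fi] := delete_leaf_iso adja la x2.
by exists (delete_leaf adja), f.
Qed.

(** The split ab|cd determines all the splits among its four points; a point is
    coded by its name [j] within the cherry [i]. *)
Lemma four_point_split (Z : qstruct) (g : bool -> bool -> Z) : treelike Z ->
  qsplit (g false false) (g true false) (g false true) (g true true) ->
  forall j1 i1 j2 i2 j3 i3 j4 i4,
    uniq [:: (j1, i1); (j2, i2); (j3, i3); (j4, i4)] ->
    qsplit (g j1 i1) (g j2 i2) (g j3 i3) (g j4 i4) = (i1 == i2).
Proof.
move=> HZ h.
have sym8 (p q s t : Z) v : qsplit p q s t = v -> ((qsplit p q s t = v) * (qsplit q p s t = v) *
    (qsplit p q t s = v) * (qsplit q p t s = v) * (qsplit s t p q = v) *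
    (qsplit t s p q = v) * (qsplit s t q p = v) * (qsplit t s q p = v))%type.
  move=> <-; have sl := treelike_swap HZ; have sr := qsplit_swapr HZ.
  have fl := treelike_flip HZ.
  do !split => //; do ?[by rewrite sl|by rewrite sr|by rewrite sl sr|by rewrite fl
    |by rewrite fl sl|by rewrite fl sr|by rewrite fl sl sr].
have o1 := sym8 _ _ _ _ _ h.
have o2 := sym8 _ _ _ _ _ (qsplit_excl HZ h).
have o3 := sym8 _ _ _ _ _ (qsplit_excl_swap HZ h).
by do 8!case=> //; rewrite ?o1 ?o2 ?o3.
Qed.

Section MarkedValues.
Variable mu : forall X Y : qstruct, embedding X Y -> Ztau.
Hypothesis hmu : is_mu_tau mu.

Section EndNode.
Variables (T : tree) (x y : T).
Hypotheses (en : end_node x y) (ny : is_node y).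
Variable a : leaf_struct T.
Hypothesis xa : adj x (val a).

Let T1 : (1 < #|T|)%N.
Proof. by apply: leq_ltn_trans (valence_lt x); apply/card_gt0P; exists (val a); rewrite inE. Qed.

Let xy : adj x y. Proof. by case: en. Qed.
Let yx : adj y x. Proof. by rewrite adj_sym. Qed.

Let leaf_neq_y (p : T) : is_leaf p -> p != y.
Proof. by apply: contraTneq => ->. Qed.

Let leaf_neq_x (p : T) : is_leaf p -> p != x.
Proof. by apply: contraTneq => ->; case: en. Qed.

Let adja z : adj (val a) z = (z == x).
Proof. by apply: valence1P => //; [exact: (valP a) | rewrite adj_sym]. Qed.

(** The base change of Y along b, c, d: the leaves [c] and [d] are taken in two
    branches beyond [y], which exist as [y] has valence at least three. *)
Lemma mu_marked_cherry : valence x = 3%N -> valence y != 2%N ->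
  mu_marked mu a = - ((tau - 2%:R) / (tau - 1)).
Proof.
move=> x3 y2; have ay := leaf_neq_y (valP a).
have [b bE] : exists b, [set z | adj x z] :\ y :\ val a = [set b].
  apply/cards1P; move: x3; rewrite /valence (cardsD1 y) inE xy.
  by rewrite (cardsD1 (val a)) !inE ay xa !add1n => -[->].
have nbrs z : adj x z -> [\/ z = y, z = val a | z = b].
  have /setP/(_ z) := bE; rewrite !inE => + xz; rewrite xz andbT.
  have [->|] := eqVneq z y; first by constructor 1.
  have [->|] := eqVneq z (val a); first by constructor 2.
  by move=> _ _ /esym/eqP; constructor 3.
have /and3P[ba by' xb] : [&& b != val a, b != y & adj x b].
  by have /setP/(_ b) := bE; rewrite !inE eqxx.
have lb : is_leaf b by case: en => _ _; apply.
have [w1 [w2 [yw1 yw2 w12 w1x w2x]]] :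
    exists w1 w2, [/\ adj y w1, adj y w2, w1 != w2, w1 != x & w2 != x].
  have : (1 < #|[set z | adj y z] :\ x|)%N.
    have : valence y = (1 + #|[set z | adj y z] :\ x|)%N.
      by rewrite /valence (cardsD1 x) inE yx.
    by have := valence_gt0 y T1; have := ny; rewrite /is_node is_leafE //; lia.
  case/card_gt1P => w1 [w2 []]; rewrite !inE => /andP[? ?] /andP[? ?] ?.
  by exists w1, w2.
have [c lc cw] := leaf_in_side yw1; have [d ld dw] := leaf_in_side yw2.
have cd : c != d.
  apply: contraTneq cw => ->; apply/negP => dw1.
  by have /disjointFr/(_ dw1) := side_disjoint yw1 yw2 w12; rewrite dw.
have notin w z : adj y w -> w != x -> z \in side w y -> z \notin side x y.
  move=> yw wx /(subsetP (proper_sub (side_nest xy yw wx))).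
  by rewrite sideC // inE.
have cS := notin _ _ yw1 w1x cw; have dS := notin _ _ yw2 w2x dw.
have nS z : adj x z -> z != y -> z \in side x y by move=> *; apply: neighbour_side.
have aS := nS _ xa ay; have bS := nS _ xb by'.
have ne p q : p \in side x y -> q \notin side x y -> p != q.
  by move=> pS; apply: contraNneq => <-.
pose bL : leaf_struct T := exist _ b lb.
pose cL : leaf_struct T := exist _ c lc.
pose dL : leaf_struct T := exist _ d ld.
pose g (j i : bool) := if i then if j then dL else cL else if j then bL else a.
have HT := treelike_leaf_struct T.
have gsplit : qsplit (g false false) (g true false) (g false true) (g true true).
  apply/qsplitP; split; last exact: (split_end_node en xa xb ay by' cS dS).
  rewrite /= !inE !negb_or -!val_eqE /= [val a == _]eq_sym ba cd.
  by rewrite !(ne (val a)) ?(ne b).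
pose f (p : leaf_struct double_star) := g (odflt false (val p).1) (val p).2.
have fE j i : f (ds_leaf j i) = g j i by [].
have inj4 j i j' i' : g j i = g j' i' -> (j, i) = (j', i').
  have := treelike_uniq HT gsplit; rewrite /= !inE !negb_or.
  move=> /and4P[/and3P[/eqP h1 /eqP h2 /eqP h3] /andP[/eqP h4 /eqP h5] /eqP h6 _].
  by case: j i j' i' => -[] [] [] //= e; exfalso; move: e;
    first [exact h1|exact h2|exact h3|exact h4|exact h5|exact h6
      |move/esym; first [exact h1|exact h2|exact h3|exact h4|exact h5|exact h6]].
have fi : injective f.
  move=> p q; have [j [i ->]] := ds_leafP p; have [j' [i' ->]] := ds_leafP q.
  by rewrite !fE => /inj4[-> ->].
have dsT := treelike_leaf_struct double_star.
have fs p q r t : uniq [:: p; q; r; t] ->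
    qsplit (f p) (f q) (f r) (f t) = qsplit p q r t.
  have [j1 [i1 ->]] := ds_leafP p; have [j2 [i2 ->]] := ds_leafP q.
  have [j3 [i3 ->]] := ds_leafP r; have [j4 [i4 ->]] := ds_leafP t => un.
  have un' : uniq [:: (j1, i1); (j2, i2); (j3, i3); (j4, i4)].
    have pi : injective (fun p : bool * bool => ds_leaf p.1 p.2).
      by move=> [? ?] [? ?] [-> ->].
    by rewrite -(map_inj_uniq pi).
  by rewrite !fE (four_point_split HT gsplit un') (four_point_split dsT ds_split un').
have femb := is_embedding_split dsT HT fi fs.
have x2 : valence x != 2%N by rewrite x3.
have ds_nadj j i : forall z, adj (val (ds_leaf j i)) z = (z == ds_center i).
  exact: ds_adj_end.
rewrite -(mu_tau_Y hmu (ds_leaf false false) double_star_is_Y); symmetry.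
have inW (p : leaf_struct T) : p != a -> exists w : qdel a, del_emb a w = p.
  by move=> pa; exists (exist _ p pa); rewrite ffunE.
have [bW bWE] : exists w : qdel a, del_emb a w = bL by apply: inW; rewrite -val_eqE.
have [cW cWE] : exists w : qdel a, del_emb a w = cL.
  by apply: inW; rewrite -val_eqE eq_sym ne.
have [dW dWE] : exists w : qdel a, del_emb a w = dL.
  by apply: inW; rewrite -val_eqE eq_sym ne.
apply: (mu_marked_transfer (mu_tau_measure hmu) (f := Embedding femb)
  (F := fun u v w => (u == bW) && uniq [:: u; v; w] || qsplit bW u v w)).
- by rewrite ffunE.
- by apply: tree_structure_del (ds_nadj _ _) _; rewrite ds_valence_center.
- exact: tree_structure_del adja x2.
move=> Z e1 e2 HZ agree; apply: (cherry_attachment (c := cW) (d := dW) HZ).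
  have eb : e1 (ds_leaf true false) = e2 bW by apply: agree; rewrite bWE ffunE.
  have ec : e1 (ds_leaf false true) = e2 cW by apply: agree; rewrite cWE ffunE.
  have ed : e1 (ds_leaf true true) = e2 dW by apply: agree; rewrite dWE ffunE.
  by rewrite -eb -ec -ed emb_split ds_split.
move=> u; rewrite -(emb_split (del_emb a)) bWE cWE dWE.
apply/negP => /qsplitP[un]; have ua := del_emb_neq u.
have ub : del_emb a u != bL by apply: contraTneq un => ->; rewrite /= !inE eqxx.
apply: (no_split_cherry en lb xb yw1 yw2 w12 cw dw).
- by rewrite -val_eqE in ub.
- by apply: leaf_neq_x; apply: (valP (del_emb a u)).
apply/negP => /nbrs[e|e|e].
- by have := leaf_neq_y (valP (del_emb a u)); rewrite e eqxx.
- by rewrite -val_eqE e eqxx in ua.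
- by rewrite -val_eqE e eqxx in ub.
Qed.

(** The base change of the star on [D], made of the leaves at [x] and one leaf
    [c] beyond [y], so that its centre has the valence of [x]. *)
Lemma mu_marked_bush : (3 < valence x)%N ->
  mu_marked mu a = (tau + 1 - (valence x)%:R) / (tau - 1).
Proof.
move=> x3; have ay := leaf_neq_y (valP a).
have cardN : valence x = (2 + #|[set z | adj x z] :\ y :\ val a|)%N.
  by rewrite /valence (cardsD1 y) inE xy (cardsD1 (val a)) !inE ay xa.
have lN z : adj x z -> z != y -> is_leaf z by case: en => _ _; apply.
have [b0 [b1 [b0N b1N b01]]] : exists b0 b1, [/\ b0 \in [set z | adj x z] :\ y :\ val a,
    b1 \in [set z | adj x z] :\ y :\ val a & b0 != b1].
  by apply/card_gt1P; lia.
have [c lc cy] := leaf_in_side xy.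
have sideN z : is_leaf z -> z \in side x y -> adj x z.
  move=> lz /(side_end_node en)[e|//]; have := leaf_neq_x lz; by rewrite e eqxx.
have Nside z : is_leaf z -> adj x z -> z \in side x y.
  by move=> lz xz; apply: neighbour_side => //; exact: leaf_neq_y.
have cS : c \notin side x y by rewrite -in_setC -sideC.
have xc : ~~ adj x c by apply: contra cS; exact: Nside.
pose cL : leaf_struct T := exist _ c lc.
have HT := treelike_leaf_struct T.
pose inD (p : leaf_struct T) := adj x (val p) || (p == cL).
pose D := {p : leaf_struct T | inD p}.
have cardD : #|{: D}| = valence x.
  rewrite card_sig cardN.
  have -> : #|[pred p | inD p]| = #|cL |: [set p : leaf_struct T | adj x (val p)]|.
    by apply: eq_card => p; rewrite !inE /inD orbC.
  rewrite cardsU1 inE xc (cardsD1 a) inE xa !add1n add2n; congr _.+2.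
  rewrite -(card_imset _ val_inj); apply: eq_card => z; rewrite !inE.
  apply/imsetP/and3P => [[p]|[za zy xz]].
    rewrite !inE => /andP[pa xp] ->; split=> //; exact: leaf_neq_y (valP p).
  exists (exist _ z (lN z xz zy)) => //.
  by rewrite !inE -val_eqE za xz.
have D3 : (2 < #|{: D}|)%N by rewrite cardD ltnW.
pose f (p : leaf_struct (star D)) : leaf_struct T := if val p is Some d then val d else a.
have fE d : f (exist _ (Some d) (star_leaf d)) = val d by [].
have fi : injective f.
  move=> p q; have [d ->] := star_leafP D3 p; have [d' ->] := star_leafP D3 q.
  by rewrite !fE => /val_inj ->.
have starT := treelike_leaf_struct (star D).
have noD p q r t : inD p -> inD q -> inD r -> inD t -> qsplit p q r t = false.
  have H (p' q' r' t' : leaf_struct T) : adj x (val p') -> adj x (val r') -> qsplit p' q' r' t' = false.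
    move=> xp xr; apply/negP => h; have [[pq _ _] _ rt] := qsplit_neq HT h.
    case/qsplitP: h => _; apply: (no_split_neighbours T1 (valP p') (valP r') xp xr).
      by rewrite eq_sym in pq; exact: pq.
    by rewrite eq_sym in rt; exact: rt.
  move=> hp hq hr ht; apply/negP => h.
  have [[pq _ _] _ rt] := qsplit_neq HT h.
  have pick (p' q' : leaf_struct T) : inD p' -> inD q' -> p' != q' -> adj x (val p') || adj x (val q').
    by rewrite /inD => /orP[->//|/eqP ->] /orP[->|/eqP ->]; rewrite ?orbT ?eqxx.
  case/orP: (pick p q hp hq pq) => hpq; case/orP: (pick r t hr ht rt) => hrt.
  - by rewrite H in h.
  - by rewrite (qsplit_swapr HT) H in h.
  - by rewrite (treelike_swap HT) H in h.
  - by rewrite (treelike_swap HT) (qsplit_swapr HT) H in h.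
have starF (p q r t : leaf_struct (star D)) : qsplit p q r t = false.
  by rewrite /qsplit !(star_rel D3).
have fs p q r t : uniq [:: p; q; r; t] ->
    qsplit (f p) (f q) (f r) (f t) = qsplit p q r t.
  move=> _; rewrite starF; have inDf z : inD (f z).
    by have [d ->] := star_leafP D3 z; rewrite fE; exact: (valP d).
  exact: noD.
have femb := is_embedding_split starT HT fi fs.
have x2 : valence x != 2%N by apply: contraTneq x3 => ->.
have aD : inD a by rewrite /inD xa.
pose s : leaf_struct (star D) := exist _ (Some (exist _ a aD)) (star_leaf _).
pose ofD (p : leaf_struct T) (hp : inD p) : leaf_struct (star D) :=
  exist _ (Some (exist _ p hp)) (star_leaf _).
have [d0 _] : exists d : D, true by exists (exist _ a aD).
have -> : (tau + 1 - (valence x)%:R) / (tau - 1) = mu_marked mu s.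
  symmetry; apply: (mu_tau_Xm hmu) => //.
  rewrite -cardD -star_valence_center.
  exact: end_node_is_star (star_end_node D3 d0) (star_leaf _).
symmetry.
have inW (p : leaf_struct T) : p != a -> exists w : qdel a, del_emb a w = p.
  by move=> pa; exists (exist _ p pa); rewrite ffunE.
have [cW cWE] : exists w : qdel a, del_emb a w = cL.
  by apply: inW; apply: contraNneq xc => e; rewrite -[c]/(val cL) e.
pose B : {set qdel a} := [set w | adj x (val (del_emb a w))].
have inB z : z \in [set z | adj x z] :\ y :\ val a ->
    exists2 w : qdel a, w \in B & val (del_emb a w) = z.
  rewrite !inE => /and3P[za zy xz].
  have [|w we] := inW (exist _ z (lN z xz zy)); first by rewrite -val_eqE.
  by exists w; rewrite ?inE we.
have [B0 B0B B0E] := inB _ b0N; have [B1 B1B B1E] := inB _ b1N.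
have B01 : B0 != B1 by apply: contraNneq b01 => e; rewrite -B0E e B1E.
have cB : cW \notin B by rewrite inE cWE.
apply: (mu_marked_transfer (mu_tau_measure hmu) (f := Embedding femb)
  (F := fun u v w => [exists b in B, qsplit b u v w])).
- by rewrite ffunE.
- apply: (@tree_structure_del (star D) s None); first exact: star_adj_leaf.
  by rewrite star_valence_center cardD.
- exact: tree_structure_del adja x2.
move=> Z e1 e2 HZ agree.
have inDB w : w \in cW |: B -> inD (del_emb a w).
  by rewrite !inE /inD => /orP[/eqP ->|->//]; rewrite cWE eqxx orbT.
have agD w (hw : w \in cW |: B) : e1 (ofD _ (inDB w hw)) = e2 w.
  by apply: agree; rewrite ffunE.
apply: (star_attachment HZ cB B0B B1B B01).
- move=> b b' u; rewrite !inE => xb xb' bb' xu uc.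
  rewrite -(emb_split (del_emb a)); apply/qsplitP; split.
    rewrite -[[:: _; _; _; _]]/(map (del_emb a) [:: b; b'; cW; u]).
    rewrite (map_inj_uniq (@emb_inj _ _ _)) /= !inE !negb_or bb' [cW == u]eq_sym uc.
    have neB z w : adj x (val (del_emb a z)) -> ~~ adj x (val (del_emb a w)) -> z != w.
      by move=> xz; apply: contraNneq => <-.
    by rewrite !neB // cWE.
  apply: (split_end_node en xb xb').
  + exact: leaf_neq_y (valP _).
  + exact: leaf_neq_y (valP _).
  + by rewrite cWE.
  + by apply: contra xu; apply: sideN; apply: (valP (del_emb a u)).
- move=> p pS; rewrite -(agD p pS) (inj_eq (@emb_inj _ _ e1)).
  apply: contraNneq (del_emb_neq p) => e.
  by have := congr1 f e; rewrite /f /= => ->.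
- by move=> p q r pS qS rS; rewrite -(agD p pS) -(agD q qS) -(agD r rS) emb_split starF.
Qed.
End EndNode.
End MarkedValues.

(** * The recursion *)

(** The factor of a node, extended by 1 to the valences of leaves and to valence
    two, so that products can range over all vertices and deletions stay uniform. *)
Definition node_factor (v : nat) : Ztau := if (v <= 2)%N then 1 else - tau_falling v.

Definition tree_weight (T : tree) : Ztau := \prod_(x : T) node_factor (valence x).

Lemma node_factor_small v : (v <= 2)%N -> node_factor v = 1.
Proof. by rewrite /node_factor => ->. Qed.

Lemma node_factorS v : (2 < v)%N ->
  node_factor v.+1 = node_factor v * (tau - v%:R).
Proof.
move=> v2; rewrite /node_factor.
have -> : (v.+1 <= 2)%N = false by rewrite leqNgt ltnW.
have -> : (v <= 2)%N = false by rewrite leqNgt v2.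
by rewrite /tau_falling big_nat_recr ?(ltnW v2) // [RHS]mulNr.
Qed.

Lemma node_factor3 : node_factor 3 = - (tau - 2%:R).
Proof.
rewrite /node_factor; have -> : (3 <= 2)%N = false by [].
by rewrite /tau_falling big_nat1.
Qed.

Lemma tree_weightE (T : tree) : reduced T ->
  tree_weight T = (-1) ^+ nnodes T * \prod_(x : T | is_node x) tau_falling (valence x).
Proof.
move=> red; rewrite /tree_weight (bigID (fun x : T => is_node x)) /=.
rewrite [X in _ * X]big1 ?mulr1 => [|x /negbNE].
  rewrite /nnodes cardsE -prodrN; apply: eq_bigr => x nx.
  have v2 := red x nx; move: nx v2; rewrite /is_node /is_leaf negb_or => /andP[v1 T1].
  have v0 : (0 < valence x)%N by apply: valence_gt0; have := @tree_nonempty T; lia.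
  by rewrite /node_factor; case: ifP => //; lia.
rewrite /is_leaf /node_factor => /orP[/eqP ->//|/eqP T1].
by have := valence_lt x; rewrite T1 ltnS leqn0 => /eqP ->.
Qed.

Lemma card_qdel (X : qstruct) (a : X) : #|X| = #|qdel a|.+1.
Proof. by rewrite [in RHS](card_sig (predC1 a)) -[LHS](cardC (pred1 a)) card1. Qed.

Lemma nleavesE (S : tree) : nleaves S = #|leaf_struct S|.
Proof. by rewrite /nleaves cardsE card_sig. Qed.

Section Delete.
Variables (T : tree) (a x : T).
Hypothesis adja : forall z, adj a z = (z == x).
Notation T' := (delete_leaf adja).

(** Only the valence of the neighbour changes; the deleted leaf has factor 1. *)
Lemma tree_weight_delete_leaf : exists P : Ztau,
  tree_weight T = P * node_factor (valence x) /\
  tree_weight T' = P * node_factor (valence x).-1.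
Proof.
have xa : x != a by have := adja x; rewrite eqxx; apply: contraTneq => ->; rewrite adj_irr.
have va : valence a = 1%N.
  by apply/eqP/cards1P; exists x; apply/setP=> z; rewrite !inE adja.
pose x' : T' := exist _ x xa.
exists (\prod_(p : T' | p != x') node_factor (valence p)).
have vx := valence_delete_leaf x'; rewrite eqxx addn1 in vx.
split; last by rewrite /tree_weight (bigD1 x') //= mulrC [valence x]vx.
rewrite /tree_weight (bigD1 a) //= va mul1r.
rewrite (big_sub (fun z => z != a)) (bigD1 x') //= mulrC; congr (_ * _).
apply: eq_bigr => p px; have := valence_delete_leaf (p : T').
case: eqP => [e|_]; last by rewrite addn0 => <-.
by case/eqP: px; apply: val_inj.
Qed.

Hypothesis la : is_leaf a.

Lemma nleaves_delete_leaf : valence x != 2%N -> nleaves T = (nleaves T').+1.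
Proof.
move=> x2; have [f fi] := delete_leaf_iso adja la x2.
by rewrite !nleavesE -(bij_eq_card fi) -card_qdel.
Qed.

Lemma nleaves_delete_leaf_smooth : valence x = 2%N -> nleaves T = nleaves T'.
Proof.
move=> x2; have [f fi] := delete_leaf_smooth_iso adja la x2.
by rewrite !nleavesE (bij_eq_card fi).
Qed.

End Delete.

Lemma formula_step (R : comUnitRingType) (u t w k : R) n :
  k / u * (w * t / u ^+ n) = w * k * t / u ^+ n.+1.
Proof. by rewrite -!exprVn exprS; ring. Qed.

Section Main.
Variable mu : forall X Y : qstruct, embedding X Y -> Ztau.
Hypothesis hmu : is_mu_tau mu.
Let mm := mu_tau_measure hmu.

Let formula (T : tree) : Ztau := tree_weight T * tau / (tau - 1) ^+ nleaves T.

Lemma mu_tree_delete_leaf (T : tree) (a x : T) (adja : forall z, adj a z = (z == x))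
    (la : is_leaf a) : valence x != 2%N ->
  mu_tree mu T = mu_marked mu (exist _ a la : leaf_struct T) * mu_tree mu (delete_leaf adja).
Proof.
move=> x2; have [f fi] := delete_leaf_iso adja la x2.
have ts : tree_structure (qdel (exist _ a la : leaf_struct T)).
  by right; exists (delete_leaf adja), f.
rewrite (mu_tree_delete mm ts); congr (_ * _).
by apply: (measure_from_empty_iso mm ts _ fi); apply: tree_structure_leaf.
Qed.

Lemma mu_tree_delete_leaf_smooth (T : tree) (a x : T) (adja : forall z, adj a z = (z == x))
    (la : is_leaf a) : valence x = 2%N ->
  mu_tree mu T = mu_tree mu (delete_leaf adja).
Proof.
move=> x2; have [f fi] := delete_leaf_smooth_iso adja la x2.
by apply: (measure_from_empty_iso mm _ _ fi); apply: tree_structure_leaf.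
Qed.

(** The prescribed values at stars and the two transfer results agree on one
    formula, whether or not [y] is a leaf. *)
Lemma mu_marked_end_node (T : tree) (x y : T) (a : leaf_struct T) :
  end_node x y -> adj x (val a) -> valence x != 2%N -> valence y != 2%N ->
  mu_marked mu a =
    if valence x == 3%N then - ((tau - 2%:R) / (tau - 1))
    else (tau + 1 - (valence x)%:R) / (tau - 1).
Proof.
move=> en xa x2 y2; have [nx xy _] := en.
have T1 : (1 < #|T|)%N.
  by apply: leq_ltn_trans (valence_lt x); apply/card_gt0P; exists y; rewrite inE.
have x3 : (2 < valence x)%N.
  by have := valence_gt0 x T1; move: nx; rewrite /is_node is_leafE //; lia.
have [ly|ny] := boolP (is_leaf y).
  have st := end_node_is_star en ly; case: eqP => [e|ne].
    by apply: (mu_tau_X3 hmu); rewrite -e.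
  by apply: (mu_tau_Xm hmu) st; lia.
case: eqP => [e|ne]; first exact: (mu_marked_cherry hmu en ny xa e y2).
by apply: (mu_marked_bush hmu en ny xa); lia.
Qed.

(** Induction on the number of vertices: the one-point tree, the single edge,
    and otherwise the deletion of a leaf (or a cherry) at an end node. *)
Lemma mu_tree_formula (T : tree) : (forall x : T, valence x != 2%N) ->
  mu_tree mu T = formula T.
Proof.
have step (S S' : tree) k : mu_tree mu S = k / (tau - 1) * mu_tree mu S' ->
    mu_tree mu S' = formula S' -> tree_weight S = tree_weight S' * k ->
    nleaves S = (nleaves S').+1 -> mu_tree mu S = formula S.
  by move=> -> -> ew el; rewrite /formula ew el formula_step.
have [n] := ubnP #|T|; elim: n => // n IH in T *; rewrite ltnS => Tn red.
have [T1|T1] := leqP #|T| 1.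
  have {}T1 : #|T| = 1%N by have := @tree_nonempty T; lia.
  have [a _] : exists a : T, true by have /card_gt0P[a _] := @tree_nonempty T; exists a.
  have allleaf (z : T) : is_leaf z by rewrite /is_leaf T1 orbT.
  have n1 : nleaves T = 1%N.
    by rewrite -T1; apply: eq_card => z; rewrite !inE allleaf.
  pose aL : leaf_struct T := exist _ a (allleaf a).
  have c0 : #|qdel aL| = 0%N.
    by apply: succn_inj; rewrite -card_qdel -nleavesE.
  have ts : tree_structure (qdel aL) by left.
  have noz (z : qdel aL) : False by have := card0_eq c0 z.
  have iso : is_iso (from_empty (qdel aL)).
    by exists (fun z => False_rect _ (noz z)); [case | move=> z; case: (noz z)].
  rewrite (mu_tree_delete mm ts) (measure_iso mm tree_structure_empty ts iso) mulr1.
  rewrite (mu_tau_X1 hmu) ?n1 // => [|z /negP[]//].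
  rewrite /formula n1 /tree_weight big1 ?mul1r // => z _.
  by have := valence_lt z; rewrite T1 ltnS leqn0 => /eqP ->.
have [r nr|/= noN] := pickP (fun z : T => is_node z); last first.
  have allleaf (z : T) : is_leaf z by apply: negbFE; exact: noN.
  have [a _] : exists a : T, true by have /card_gt0P[a _] := @tree_nonempty T; exists a.
  have /cards1P[x ex] : valence a == 1%N by rewrite -is_leafE.
  have ax : adj a x by have := in_set1 x x; rewrite -ex inE eqxx.
  have xa : adj x a by rewrite adj_sym.
  have adja := valence1P T1 (allleaf a) ax.
  have adjx := valence1P T1 (allleaf x) xa.
  have v1 (z : T) : valence z = 1%N by apply/eqP; rewrite -is_leafE.
  have x2 : valence x != 2%N by rewrite v1.
  have T2 : nleaves T = 2%N.
    transitivity #|[set a; x]|; last first.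
      by rewrite cards2; case: eqVneq ax => // ->; rewrite adj_irr.
    apply: eq_card => z; rewrite !inE allleaf; symmetry.
    have := sideC ax; rewrite (side_leaf adja) (side_leaf adjx) => /setP/(_ z).
    by rewrite !inE => ->; case: (_ == a).
  apply: (step T (delete_leaf adja) 1).
  - rewrite (mu_tree_delete_leaf adja (allleaf a) x2); congr (_ * _).
    apply: (mu_tau_X2 hmu) => // z; rewrite /is_node allleaf //.
  - apply: IH => [|p]; first by move: Tn; rewrite (card_delete_leaf adja).
    by have := valence_delete_leaf p; rewrite v1; lia.
  - have [P [-> ->]] := tree_weight_delete_leaf adja.
    by rewrite v1 !node_factor_small // !mulr1.
  - exact: nleaves_delete_leaf adja (allleaf a) x2.
have [x [y en]] := end_node_exists T1 nr; have [nx xy lN] := en.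
have x3 : (2 < valence x)%N.
  have := valence_gt0 x T1; have := red x; move: nx; by rewrite /is_node is_leafE //; lia.
have [k vk] : exists k, valence x = k.+3 by exists (valence x - 3)%N; lia.
have [a [b [ax bx ab [ay by']]]] : exists a b, [/\ adj x a, adj x b, a != b & a != y /\ b != y].
  have : (1 < #|[set z | adj x z] :\ y|)%N.
    by move: x3; rewrite /valence (cardsD1 y) inE xy; lia.
  case/card_gt1P => a [b []]; rewrite !inE => /andP[? ?] /andP[? ?] ?.
  by exists a, b.
have la := lN a ax ay; have lb := lN b bx by'.
have xa : adj a x by rewrite adj_sym.
have adja := valence1P T1 la xa.
have xb : adj b x by rewrite adj_sym.
have adjb := valence1P T1 lb xb.
pose aL : leaf_struct T := exist _ a la.
have muA := mu_marked_end_node (a := aL) en ax (red x) (red y).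
have muT := mu_tree_delete_leaf adja la (red x); rewrite muA in muT.
have [P [wT wT']] := tree_weight_delete_leaf adja.
have lT := nleaves_delete_leaf adja la (red x).
have cT := card_delete_leaf adja.
pose T' := delete_leaf adja; rewrite -/T' in muT wT' lT cT.
case: k vk => [e3|k vk]; last first.
  rewrite vk in muT wT wT'; apply: step muT _ _ lT.
    apply: IH => [|p]; first by rewrite -ltnS -cT ltnS.
    have := valence_delete_leaf p; case: eqP => [->|_].
      by rewrite addn1 vk => -[<-].
    by rewrite addn0 => <-.
  rewrite wT wT' -[in RHS]mulrA; congr (_ * _).
  by rewrite node_factorS //; congr (_ * _); rewrite mulrSr; ring.
rewrite e3 eqxx in muT; rewrite e3 in wT wT'.
have xna : x != a by apply: contraTneq xa => ->; rewrite adj_irr.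
have bna : b != a by rewrite eq_sym.
pose b' : T' := exist _ b bna; pose x' : T' := exist _ x xna.
have adjb' z : adj b' z = (z == x') by exact: adjb.
have lb' : is_leaf b' by rewrite (is_leaf_delete_leaf b' (red x)).
have x'2 : valence x' = 2%N.
  by have := valence_delete_leaf x'; rewrite eqxx e3 addn1 => -[<-].
have [P' [wT2 wT3]] := tree_weight_delete_leaf adjb'.
rewrite x'2 in wT2 wT3.
rewrite (mu_tree_delete_leaf_smooth adjb' lb' x'2) in muT.
rewrite -mulNr in muT; apply: step muT _ _ _.
- apply: IH => [|p].
    by move: Tn; rewrite cT (card_delete_leaf adjb'); apply: ltnW.
  have := valence_delete_leaf p; case: eqP => [->|px].
    by rewrite x'2 addn1 => -[<-].
  rewrite addn0 => <-; have := valence_delete_leaf (val p).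
  case: eqP => [e|_]; first by case: px; apply: val_inj.
  by rewrite addn0 => <-.
- rewrite wT3 -[node_factor _]/(node_factor 2) -wT2 wT' wT node_factor3.
  by rewrite node_factor_small // mulr1.
- by rewrite lT (nleaves_delete_leaf_smooth adjb' lb' x'2).
Qed.
End Main.

Theorem proposition3p10
    (mu : forall X Y : qstruct, embedding X Y -> Ztau)
    (hmu : is_mu_tau mu)
    (T : tree) (hT : reduced T) :
  mu_tree mu T =
    (-1) ^+ nnodes T * tau / (tau - 1) ^+ nleaves T *
    \prod_(x : T | is_node x) tau_falling (valence x).
Proof.
have red (x : T) : valence x != 2%N.
  apply/eqP => x2; apply: (hT x _ x2); rewrite /is_node /is_leaf x2 /=.
  by have := valence_lt x; rewrite x2; case: #|T| => // -[].
rewrite (mu_tree_formula hmu red) (tree_weightE hT).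
by rewrite [RHS]mulrAC; congr (_ * _); exact: mulrAC.
Qed.
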